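(* The $(r,m)$-rank of every vertex of a graph $G$ with $n$ vertices can be computed (for all vertices simultaneously) in time $\mathcal{O}(r^m\cdot n^4)$.
   Context: $N_r^G(v)$ is the closed $r$-neighborhood of $v$ (vertices reachable from $v$ by a path with at most $r$ edges, including $v$); $G-S$ is the subgraph induced on $V(G)\setminus S$. The $(r,m)$-rank of vertices of $G$ (values in $\mathbb{N}\cup\{\infty\}$) is defined by the following procedure: initially every vertex has rank $\infty$; in rounds $i=1,2,3,\dots$, every vertex $v$ that currently has rank $\infty$ receives rank $i$ if there exists a set $S\subseteq V(G)\setminus\{v\}$ with $|S|\le m$ such that every vertex of $N_r^{G-S}(v)\setminus\{v\}$ received a finite rank in rounds $1,\dots,i-1$ (all vertices are checked simultaneously in a round); the procedure stops when all vertices have finite rank or a round assigns no new rank. Vertices still of rank $\infty$ keep rank $\infty$. *)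

(* Defs.v *)
From mathcomp Require Import all_boot.
Set Implicit Arguments. Unset Strict Implicit. Unset Printing Implicit Defensive.

(* Graphs: a finite simple graph on vertex set 'I_n is a symmetric,          *)
(* irreflexive relation e : rel 'I_n.                                       *)

Section Rank.
Variables (n : nat) (e : rel 'I_n).

(* vertices reachable from v by a path with at most k edges in G - S
   (v itself is included; v is assumed not in S). *)
Fixpoint ball (S : {set 'I_n}) (v : 'I_n) (k : nat) : {set 'I_n} :=
  match k with
  | 0 => [set v]
  | k'.+1 => ball S v k' :|:
             [set w | (w \notin S) && [exists u in ball S v k', e u w]]
  end.

Definition nbhd (r : nat) (S : {set 'I_n}) (v : 'I_n) : {set 'I_n} :=
  ball S v r.

(* ranked r m i = set of vertices that received a finite rank in rounds
   1..i of the (r,m)-rank procedure. *)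
Fixpoint ranked (r m : nat) (i : nat) : {set 'I_n} :=
  match i with
  | 0 => set0
  | i'.+1 => ranked r m i' :|:
      [set v | (v \notin ranked r m i') &&
               [exists S : {set 'I_n},
                  [&& #|S| <= m, v \notin S &
                      (nbhd r S v :\ v) \subset ranked r m i']]]
  end.

(* (r,m)-rank of v: Some k means rank k (k >= 1), None means rank infinity. *)
Definition is_rank (r m : nat) (v : 'I_n) (k : option nat) : Prop :=
  match k with
  | Some k => 0 < k /\ v \in ranked r m k /\ v \notin ranked r m k.-1
  | None => forall i, v \notin ranked r m i
  end.

End Rank.

(* Model of computation: unit-cost RAM (no multiplication), memory nat->nat *)

Inductive instr : Type :=
  | IConst of nat & nat
  | IAdd of nat & nat & nat
  | ISub of nat & nat & nat    (* ISub i j k   : M[i] := M[j] - M[k] (trunc)*)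
  | ILoad of nat & nat
  | IStore of nat & nat
  | IJz of nat & nat
  | IJmp of nat
  | IHalt.

Definition program := seq instr.

Record state := State { st_pc : nat; st_mem : nat -> nat }.

Definition upd (M : nat -> nat) (a x : nat) : nat -> nat :=
  fun b => if b == a then x else M b.

Definition step (P : program) (s : state) : option state :=
  let M := st_mem s in
  let p := st_pc s in
  if p < size P then
    match nth IHalt P p with
    | IConst i c => Some (State p.+1 (upd M i c))
    | IAdd i j k => Some (State p.+1 (upd M i (M j + M k)))
    | ISub i j k => Some (State p.+1 (upd M i (M j - M k)))
    | ILoad i j => Some (State p.+1 (upd M i (M (M j))))
    | IStore i j => Some (State p.+1 (upd M (M i) (M j)))
    | IJz i l => Some (State (if M i == 0 then l else p.+1) M)
    | IJmp l => Some (State l M)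
    | IHalt => None
    end
  else None.

Fixpoint run (P : program) (t : nat) (s : state) : state :=
  match t with
  | 0 => s
  | t'.+1 => match step P s with
             | Some s' => run P t' s'
             | None => s
             end
  end.

Definition halted (P : program) (s : state) : Prop := step P s = None.

(* input encoding: M[0] = n, M[1] = r, M[2] = m,
   M[3 + i*n + j] = 1 if ij is an edge, 0 otherwise; all other cells 0;
   execution starts at pc = 0. *)
Definition input_mem (n : nat) (e : rel 'I_n) (r m : nat) : nat -> nat :=
  fun a =>
    if a == 0 then n else if a == 1 then r else if a == 2 then m
    else if (3 <= a) && (a < 3 + n * n) then
      let b := a - 3 in
      match insub (b %/ n), insub (b %% n) with
      | Some i, Some j => nat_of_bool (e i j)
      | _, _ => 0
      end
    else 0.

Definition init_state (n : nat) (e : rel 'I_n) (r m : nat) : state :=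
  State 0 (input_mem e r m).

(* output encoding: cell 3 + n*n + v holds 0 for rank infinity,
   and k for finite rank k. *)
Definition decode_rank (x : nat) : option nat :=
  if x == 0 then None else Some x.

Definition output_rank (n : nat) (M : nat -> nat) (v : 'I_n) : option nat :=
  decode_rank (M (3 + n * n + v)).

(* Main.v *)
Require Import Defs.
From mathcomp Require Import all_boot zify.
Set Implicit Arguments. Unset Strict Implicit. Unset Printing Implicit Defensive.

(** A vertex [v] gets rank [i + 1] iff some set of at most [m] vertices separates
    it from the other unranked vertices within distance [r].  Breadth-first search
    from [v] in [G - S] either shows that [S] separates, or yields a path of at
    most [r] edges to an unranked vertex; every separating superset of [S] contains
    one of the at most [r] vertices of this path, so one branches on them.  The
    search tree has at most [2 r^m] nodes for [r >= 2]; for [r = 1] it is a path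
    with at most [n + 1] nodes, but then each search only scans one row of the
    adjacency matrix.  Hence a vertex is tested in time [O(r^m n^2)], and [n]
    rounds of [n] tests suffice.  Radii above [n] may be replaced by [n].

    The RAM program comes from a while language over registers and eight unbounded
    arrays, which are interleaved in memory so that their cells never overlap. *)

(** The [n * n] tests use up half of the factor [n ^ 4], so each search node may cost only
    [O(n ^ 2)]. Breadth-first search loops over its radius even when layers are empty, and for
    [m = 0] the bound has no factor [r] to pay for that; this is why large radii are cut down. For
    [r = 1] the factor [r ^ m] gives no credit for the depth [m], but every level deletes a new
    vertex. Time is counted at source level: a clock ticks at each elementary statement and each
    guard, and compiled code spends at most its own size in instructions per tick. The language has
    no recursion, so the depth-first search is one loop with an explicit stack, and its subtrees are
    specified by what the rest of that loop does. *)

Lemma run_add P t1 t2 s : run P (t1 + t2) s = run P t2 (run P t1 s).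
Proof.
elim: t1 s => [|t1 IH] s //=; case E: (step P s) => [s'|] //=.
by case: t2 {IH} => [|t2] //=; rewrite E.
Qed.

(** * Structured RAM code and its assembly into flat programs *)

Notation memory := (nat -> nat).

Inductive code : Type :=
  | Op of instr
  | Sq of code & code
  | Br of nat & code & code
  | Lp of nat & code.

Definition op_eff (i : instr) (M : memory) : option memory :=
  match i with
  | IConst i c => Some (upd M i c)
  | IAdd i j k => Some (upd M i (M j + M k))
  | ISub i j k => Some (upd M i (M j - M k))
  | ILoad i j => Some (upd M i (M (M j)))
  | IStore i j => Some (upd M (M i) (M j))
  | _ => None
  end.

(** The last index is the exact number of instructions executed after assembly: a taken branch pays
    for its test and for the jump over the other branch, an iteration for its test and the jump
    back. *)
Inductive crun : code -> memory -> memory -> nat -> Prop :=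
  | crun_op i M M' : op_eff i M = Some M' -> crun (Op i) M M' 1
  | crun_sq a b M M1 M2 t1 t2 :
      crun a M M1 t1 -> crun b M1 M2 t2 -> crun (Sq a b) M M2 (t1 + t2)
  | crun_brT r a b M M' t :
      M r != 0 -> crun a M M' t -> crun (Br r a b) M M' (1 + (t + 1))
  | crun_brF r a b M M' t :
      M r = 0 -> crun b M M' t -> crun (Br r a b) M M' (1 + t)
  | crun_lp0 r a M : M r = 0 -> crun (Lp r a) M M 1
  | crun_lpS r a M M1 M2 t1 t2 :
      M r != 0 -> crun a M M1 t1 -> crun (Lp r a) M1 M2 t2 ->
      crun (Lp r a) M M2 (1 + (t1 + (1 + t2))).

Fixpoint csize (c : code) : nat :=
  match c with
  | Op _ => 1
  | Sq a b => csize a + csize b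
  | Br _ a b => csize a + csize b + 2
  | Lp _ a => csize a + 2
  end.

Fixpoint assemble (o : nat) (c : code) : program :=
  match c with
  | Op i => [:: i]
  | Sq a b => assemble o a ++ assemble (o + csize a) b
  | Br r a b =>
      IJz r (o + csize a + 2) :: assemble o.+1 a ++
      IJmp (o + csize a + csize b + 2) :: assemble (o + csize a + 2) b
  | Lp r a => IJz r (o + csize a + 2) :: assemble o.+1 a ++ [:: IJmp o]
  end.

Lemma size_assemble c o : size (assemble o c) = csize c.
Proof.
elim: c o => [i|a IHa b IHb|r a IHa b IHb|r a IHa] o //=;
  rewrite size_cat /= ?IHa ?IHb; lia.
Qed.

Lemma step_at pre i post M :
  step (pre ++ i :: post) (State (size pre) M) =
  match i with
  | IJz r l => Some (State (if M r == 0 then l else (size pre).+1) M)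
  | IJmp l => Some (State l M)
  | _ => omap (State (size pre).+1) (op_eff i M)
  end.
Proof.
rewrite /step /= size_cat /= -{1}(addn0 (size pre)) ltn_add2l /=.
by rewrite nth_cat ltnn subnn /=; case: i.
Qed.

(** Jump targets are absolute, so the context is kept arbitrary: in each case the neighbouring
    instructions are absorbed into [pre] and [post] before an induction hypothesis is applied. *)
Lemma run_assemble c M M' t : crun c M M' t ->
  forall pre post, run (pre ++ assemble (size pre) c ++ post) t (State (size pre) M)
    = State (size pre + csize c) M'.
Proof.
elim=> {c M M' t}.
- move=> i M M' E pre post /=; rewrite step_at.
  by case: i E => //= *; rewrite addn1; congr State; congruence.
- move=> a b M M1 M2 t1 t2 _ IHa _ IHb pre post /=.
  rewrite run_add -catA IHa.
  have := IHb (pre ++ assemble (size pre) a) post.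
  by rewrite size_cat size_assemble -!catA addnA.
- move=> r a b M M' t Mr _ IH pre post.
  rewrite run_add /= step_at (negbTE Mr) run_add.
  have := IH (rcons pre (IJz r (size pre + csize a + 2)))
    (IJmp (size pre + csize a + csize b + 2) ::
       assemble (size pre + csize a + 2) b ++ post).
  rewrite size_rcons cat_rcons -!catA /= => ->.
  have := step_at (pre ++ IJz r (size pre + csize a + 2) :: assemble (size pre).+1 a)
    (IJmp (size pre + csize a + csize b + 2))
    (assemble (size pre + csize a + 2) b ++ post) M'.
  rewrite !size_cat /= size_assemble -!catA /= [size pre + _.+1](addnS _ (csize a)).
  rewrite -[(_ + _).+1](addSn _ (csize a)) => ->.
  by congr State; lia.
- move=> r a b M M' t Mr _ IH pre post.
  rewrite run_add /= step_at Mr /=.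
  have := IH (pre ++ IJz r (size pre + csize a + 2) :: assemble (size pre).+1 a ++
    [:: IJmp (size pre + csize a + csize b + 2)]) post.
  rewrite !size_cat /= size_cat size_assemble /= -!catA /= -!catA /=.
  have -> : size pre + (csize a + 1).+1 = size pre + csize a + 2 by lia.
  by move=> ->; congr State; lia.
- by move=> r a M Mr pre post /=; rewrite step_at Mr /=; congr State; lia.
- move=> r a M M1 M2 t1 t2 Mr _ IHa _ IHl pre post.
  rewrite run_add [run _ 1 _]/= step_at (negbTE Mr) run_add.
  have := IHa (rcons pre (IJz r (size pre + csize a + 2))) (IJmp (size pre) :: post).
  rewrite size_rcons cat_rcons /= -!catA /= => ->.
  have := step_at (pre ++ IJz r (size pre + csize a + 2) :: assemble (size pre).+1 a)
    (IJmp (size pre)) post M1.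
  rewrite !size_cat /= size_assemble -!catA /= [size pre + _.+1](addnS _ (csize a)).
  rewrite -[(_ + _).+1](addSn _ (csize a)) => ->.
  by have := IHl pre post; rewrite /= -!catA.
Qed.

Lemma assemble_halts c M M' t : crun c M M' t ->
  let P := assemble 0 c ++ [:: IHalt] in
  run P t (State 0 M) = State (csize c) M' /\ halted P (State (csize c) M').
Proof.
move=> /run_assemble/(_ [::] [:: IHalt]) /= E; split=> //.
have := step_at (assemble 0 c) IHalt [::] M'.
by rewrite size_assemble.
Qed.

(** * A while language with registers and arrays, and its compiler *)

Inductive expr : Type :=
  | Cst of nat
  | Rg of nat
  | Plus of expr & expr
  | Minus of expr & expr
  | Get of nat & expr.

Inductive cmd : Type :=
  | Skip
  | Asg of nat & expr
  | Put of nat & expr & expr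
  | Seq of cmd & cmd
  | If of expr & cmd & cmd
  | While of expr & cmd.

(* [clk] is a ghost step counter. *)
Record store := Store { reg : nat -> nat; arr : nat -> nat -> nat; clk : nat }.

Fixpoint eval (s : store) (e : expr) : nat :=
  match e with
  | Cst c => c
  | Rg r => reg s r
  | Plus a b => eval s a + eval s b
  | Minus a b => eval s a - eval s b
  | Get k a => arr s k (eval s a)
  end.

Definition tick s := Store (reg s) (arr s) (clk s).+1.
Definition set_reg s r x := Store (upd (reg s) r x) (arr s) (clk s).+1.
Definition set_arr s k i x :=
  Store (reg s) (fun k' => if k' == k then upd (arr s k) i x else arr s k') (clk s).+1.

Inductive exec : cmd -> store -> store -> Prop :=
  | exec_skip s : exec Skip s (tick s)
  | exec_asg s r e : exec (Asg r e) s (set_reg s r (eval s e))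
  | exec_put s k a b : exec (Put k a b) s (set_arr s k (eval s a) (eval s b))
  | exec_seq a b s s1 s2 : exec a s s1 -> exec b s1 s2 -> exec (Seq a b) s s2
  | exec_ifT e a b s s' : eval s e != 0 -> exec a (tick s) s' -> exec (If e a b) s s'
  | exec_ifF e a b s s' : eval s e = 0 -> exec b (tick s) s' -> exec (If e a b) s s'
  | exec_while0 e a s : eval s e = 0 -> exec (While e a) s (tick s)
  | exec_whileS e a s s1 s2 : eval s e != 0 -> exec a (tick s) s1 ->
      exec (While e a) s1 s2 -> exec (While e a) s s2.

(* Memory layout of a [store]: cells below 39 are registers, cell 39 holds the
   base address of the eight interleaved arrays, cells 40 to 99 are temporaries. *)
Definition represents (lo : nat) (s : store) (M : memory) : Prop :=
  [/\ 100 + lo <= M 39, forall r, r < 39 -> M r = reg s r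
    & forall k i, k < 8 -> M (M 39 + 8 * i + k) = arr s k i].

(** [d + depth e] is the last temporary that [expr_code e d] touches; a second operand is computed
    one cell higher, so that the first survives. *)
Fixpoint depth (e : expr) : nat :=
  match e with
  | Cst _ => 0
  | Rg _ => 1
  | Plus a b | Minus a b => maxn (depth a) (depth b).+1
  | Get _ a => maxn 1 (depth a)
  end.

Fixpoint wf_expr (e : expr) : bool :=
  match e with
  | Cst _ => true
  | Rg r => r < 39
  | Plus a b | Minus a b => wf_expr a && wf_expr b
  | Get k a => (k < 8) && wf_expr a
  end.

Fixpoint wf_cmd (c : cmd) : bool :=
  match c with
  | Skip => true
  | Asg r e => [&& r < 39, wf_expr e & depth e < 59]
  | Put k a b => [&& k < 8, wf_expr a, wf_expr b, depth a < 58 & depth b < 58]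
  | Seq a b => wf_cmd a && wf_cmd b
  | If e a b => [&& wf_expr e, depth e < 59, wf_cmd a & wf_cmd b]
  | While e a => [&& wf_expr e, depth e < 59 & wf_cmd a]
  end.

Definition addr_code (k d : nat) : code :=
  Sq (Op (IAdd d d d)) (Sq (Op (IAdd d d d)) (Sq (Op (IAdd d d d))
    (Sq (Op (IAdd d d 39)) (Sq (Op (IConst d.+1 k)) (Op (IAdd d d d.+1)))))).

Fixpoint expr_code (e : expr) (d : nat) : code :=
  match e with
  | Cst c => Op (IConst d c)
  | Rg r => Sq (Op (IConst d.+1 0)) (Op (IAdd d r d.+1))
  | Plus a b => Sq (expr_code a d) (Sq (expr_code b d.+1) (Op (IAdd d d d.+1)))
  | Minus a b => Sq (expr_code a d) (Sq (expr_code b d.+1) (Op (ISub d d d.+1)))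
  | Get k a => Sq (expr_code a d) (Sq (addr_code k d) (Op (ILoad d d)))
  end.

(** [Lp] tests a register, so the guard of a [While] is compiled twice: before the loop and at the
    end of its body. Moves are additions of zero. *)
Fixpoint cmd_code (c : cmd) : code :=
  match c with
  | Skip => Op (IConst 40 0)
  | Asg r e =>
      Sq (expr_code e 40) (Sq (Op (IConst 41 0)) (Op (IAdd r 40 41)))
  | Put k a b =>
      Sq (expr_code a 40) (Sq (addr_code k 40)
        (Sq (expr_code b 41) (Op (IStore 40 41))))
  | Seq a b => Sq (cmd_code a) (cmd_code b)
  | If e a b => Sq (expr_code e 40) (Br 40 (cmd_code a) (cmd_code b))
  | While e a =>
      Sq (expr_code e 40) (Lp 40 (Sq (cmd_code a) (expr_code e 40)))
  end.

Lemma addr_code_run M k d : 39 < d ->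
  exists2 M', crun (addr_code k d) M M' 6 &
    M' d = M 39 + 8 * M d + k /\ forall a, a < d \/ d.+1 < a -> M' a = M a.
Proof.
move=> d_gt; eexists.
  by repeat (eapply (@crun_sq _ _ _ _ _ 1); first by apply: crun_op); apply: crun_op.
rewrite /upd; split=> [|a Ha]; do ?[case: eqP => ?]; lia.
Qed.

Lemma represents_eq lo s M M' : represents lo s M ->
  (forall a, a < 40 \/ 100 <= a -> M' a = M a) -> represents lo s M'.
Proof.
case=> base regs arrs same; have E : M' 39 = M 39 by apply: same; left.
split=> [|r Hr|k i Hk]; rewrite ?E //.
  by rewrite same ?regs //; left; lia.
by rewrite same ?arrs //; right; lia.
Qed.

(** Expression code is straight-line: each instruction runs once, hence the time is the code
    size. *)
Lemma expr_code_run lo s e : wf_expr e -> forall d M,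
  39 < d -> d + depth e < 99 -> represents lo s M ->
  exists2 M', crun (expr_code e d) M M' (csize (expr_code e d)) &
    M' d = eval s e /\ forall a, a < d \/ 100 <= a -> M' a = M a.
Proof.
have frame d M M' (_ : 39 < d) : (forall a, a < d \/ 100 <= a -> M' a = M a) ->
  represents lo s M -> represents lo s M'.
  by move=> same /represents_eq; apply=> a Ha; apply: same; lia.
have bin (op : nat -> nat -> nat) (o : nat -> nat -> nat -> instr) a b d M :
    (forall i j k M1, op_eff (o i j k) M1 = Some (upd M1 i (op (M1 j) (M1 k)))) ->
    (forall d M, 39 < d -> d + depth a < 99 -> represents lo s M ->
      exists2 M', crun (expr_code a d) M M' (csize (expr_code a d)) &
      M' d = eval s a /\ forall x, x < d \/ 100 <= x -> M' x = M x) ->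
    (forall d M, 39 < d -> d + depth b < 99 -> represents lo s M ->
      exists2 M', crun (expr_code b d) M M' (csize (expr_code b d)) &
      M' d = eval s b /\ forall x, x < d \/ 100 <= x -> M' x = M x) ->
    39 < d -> d + maxn (depth a) (depth b).+1 < 99 -> represents lo s M ->
    exists2 M', crun (Sq (expr_code a d) (Sq (expr_code b d.+1) (Op (o d d d.+1)))) M M'
       (csize (expr_code a d) + (csize (expr_code b d.+1) + 1)) &
      M' d = op (eval s a) (eval s b) /\ forall x, x < d \/ 100 <= x -> M' x = M x.
  move=> eff IHa IHb Hd Hm rM.
  have [||| M1 run1 [E1 same1]] := IHa d M => //; first by lia.
  have rM1 := frame _ _ _ Hd same1 rM.
  have [|||M2 run2 [E2 same2]] := IHb d.+1 M1 => //; [by lia | by lia |].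
  exists (upd M2 d (op (eval s a) (eval s b))); last first.
    split=> [|x Hx]; rewrite /upd ?eqxx //; case: eqP => ?; first lia.
    by rewrite same2 ?same1 //; lia.
  apply: crun_sq run1 (crun_sq run2 (crun_op _)).
  by rewrite eff E2 same2 ?E1 //; left.
elim: e => [c|r|a IHa b IHb|a IHa b IHb|k a IHa] /=.
- move=> _ d M Hd Hm _; exists (upd M d c); first exact: crun_op.
  by rewrite /upd eqxx; split=> // a Ha; case: eqP => //; lia.
- move=> Hr d M Hd Hm [_ regs _]; eexists.
    by apply: (@crun_sq _ _ _ _ _ 1 1); apply: crun_op.
  rewrite /upd !eqxx; split=> [|a Ha]; last by do ?case: eqP; lia.
  by rewrite -regs // addn0; case: eqP => //; lia.
- move=> /andP[/IHa{}IHa /IHb{}IHb] d M; exact: (bin addn IAdd).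
- move=> /andP[/IHa{}IHa /IHb{}IHb] d M; exact: (bin subn ISub).
- move=> /andP[Hk /IHa{}IHa] d M Hd Hm rM.
  have [|||M1 run1 [E1 same1]] := IHa d M => //; first by lia.
  have [base _ arrs] := frame _ _ _ Hd same1 rM.
  have [M2 run2 [E2 same2]] := addr_code_run M1 k Hd.
  exists (upd M2 d (arr s k (eval s a))).
    apply: crun_sq run1 (crun_sq run2 (crun_op _)).
    by rewrite /= E2 E1 same2 ?arrs //; right; lia.
  split=> [|x Hx]; rewrite /upd ?eqxx //; case: eqP => ?; first lia.
  by rewrite same2 ?same1 //; lia.
Qed.

Lemma crun_sqI a b M M2 t : crun (Sq a b) M M2 t ->
  exists M1 t1 t2, [/\ crun a M M1 t1, crun b M1 M2 t2 & t = t1 + t2].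
Proof.
move E: (Sq a b) => c H; case: H E => // a' b' M0 M1 M2' t1 t2 Ha Hb [-> ->].
by exists M1, t1, t2.
Qed.

(** Between two ticks only straight-line code and a few jumps are executed, at most [W]
    instructions. [W] is any upper bound on the size, so that one value serves all subcommands. *)
Lemma cmd_code_run lo c s s' : exec c s s' -> wf_cmd c ->
  forall W M, csize (cmd_code c) <= W -> represents lo s M ->
  exists M' t, [/\ crun (cmd_code c) M M' t, represents lo s' M'
                 & t + W * clk s <= W * clk s'].
Proof.
elim=> {c s s'} /=.
- move=> s _ W M HW rM; exists (upd M 40 0), 1; split; first exact: crun_op.
    by apply: represents_eq rM _ => a Ha; rewrite /upd; case: eqP => //; lia.
  by rewrite /= mulnS; lia.
- move=> s r e /and3P[Hr we de] W M HW rM.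
  have [||M1 run1 [E1 same1]] := expr_code_run we (d := 40) _ _ rM => //.
  eexists; eexists; split.
  + apply: crun_sq run1 (crun_sq (crun_op _) (crun_op _)) => //.
  + have [base regs arrs] := represents_eq rM same1.
    split=> [|r' Hr'|k i Hk]; rewrite /upd.
    * by do ?[case: eqP => ?]; lia.
    * rewrite /= /upd E1 addn0; case: eqP => // _.
      by rewrite -regs //; case: eqP => // ?; lia.
    * have -> : (39 == r) = false by lia.
      rewrite /= -arrs //; do ?[case: eqP => ?]; lia.
  + by rewrite /= mulnS; lia.
- move=> s k a b /and5P[Hk wa wb da db] W M HW rM.
  have [||M1 run1 [E1 same1]] := expr_code_run wa (d := 40) _ _ rM => //; first by lia.
  have rM1 := represents_eq rM same1.
  have [//|M2 run2 [E2 same2]] := addr_code_run M1 k (d := 40).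
  have rM2 : represents lo s M2 by apply: represents_eq rM1 _ => x Hx; apply: same2; lia.
  have [||M3 run3 [E3 same3]] := expr_code_run wb (d := 41) _ _ rM2 => //.
  have rM3 : represents lo s M3 by apply: represents_eq rM2 _ => x Hx; apply: same3; lia.
  have B : M3 39 = M1 39 by rewrite same3 ?same2; auto.
  have A : M3 40 = M3 39 + 8 * eval s a + k by rewrite same3 ?E2 ?E1 ?B //; auto.
  eexists; eexists; split.
  + by apply: crun_sq run1 (crun_sq run2 (crun_sq run3 (crun_op _))).
  + rewrite A E3; case: rM3 => base regs arrs.
    split=> [|r' Hr'|k' i Hk']; rewrite /upd.
    * by case: eqP => ?; lia.
    * by case: eqP => ?; [lia | exact: regs].
    * have -> : (39 == M3 39 + 8 * eval s a + k) = false by lia.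
      rewrite [LHS]/= (arrs k' i) //.
      have -> : (M3 39 + 8 * i + k' == M3 39 + 8 * eval s a + k) =
                (k' == k) && (i == eval s a) by lia.
      rewrite /=.
      by have [->|//] := eqVneq k' k; rewrite /upd /=.
  + by rewrite /= mulnS; lia.
- move=> a b s s1 s2 _ IHa _ IHb /andP[wa wb] W M HW rM.
  have [|M1 [t1 [run1 rM1 le1]]] := IHa wa W M _ rM; first lia.
  have [|M2 [t2 [run2 rM2 le2]]] := IHb wb W M1 _ rM1; first lia.
  by exists M2, (t1 + t2); split=> //; [apply: crun_sq run1 run2 | lia].
- move=> e a b s s' He _ IH /and4P[we de wa wb] W M HW rM.
  have [||M1 run1 [E1 same1]] := expr_code_run we (d := 40) _ _ rM => //.
  have [|M2 [t2 [run2 rM2 le2]]] := IH wa W M1 _ (represents_eq rM same1); first lia.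
  exists M2; eexists; split=> //.
    by apply: crun_sq run1 (crun_brT _ _ run2); rewrite E1.
  by move: le2; rewrite /= mulnS; lia.
- move=> e a b s s' He _ IH /and4P[we de wa wb] W M HW rM.
  have [||M1 run1 [E1 same1]] := expr_code_run we (d := 40) _ _ rM => //.
  have [|M2 [t2 [run2 rM2 le2]]] := IH wb W M1 _ (represents_eq rM same1); first lia.
  exists M2; eexists; split=> //.
    by apply: crun_sq run1 (crun_brF _ _ run2); rewrite E1.
  by move: le2; rewrite /= mulnS; lia.
- move=> e a s He /and3P[we de wa] W M HW rM.
  have [||M1 run1 [E1 same1]] := expr_code_run we (d := 40) _ _ rM => //.
  exists M1; eexists; split.
  + by apply: crun_sq run1 (crun_lp0 _ _); rewrite E1.
  + exact: (represents_eq rM same1).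
  + by rewrite /= mulnS; lia.
- move=> e a s s1 s2 He _ IHa _ IHl /and3P[we de wa] W M HW rM.
  have [||M1 run1 [E1 same1]] := expr_code_run we (d := 40) _ _ rM => //.
  have [|M2 [t2 [run2 rM2 le2]]] := IHa wa W M1 _ (represents_eq rM same1); first lia.
  (* The compiled rest of the loop starts by evaluating the guard; that part is split off to become
     the end of the present iteration. *)
  have [|//|M3 [t3 [/crun_sqI[M4 [t4 [t5 [run4 run5 E]]]] rM3 le3]]] := IHl _ W M2 _ rM2.
    by rewrite we de.
  exists M3; eexists; split=> //.
    apply: crun_sq run1 (crun_lpS _ (crun_sq run2 run4) run5).
    by rewrite E1.
  by move: le2; rewrite /= mulnS; lia.
Qed.

(** * Weakest preconditions for total correctness, and frame conditions *)

Definition wp (c : cmd) (Q : store -> Prop) (s : store) : Prop :=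
  exists2 s', exec c s s' & Q s'.

Lemma wp_skip Q s : Q (tick s) -> wp Skip Q s.
Proof. by exists (tick s) => //; apply: exec_skip. Qed.

Lemma wp_asg r e Q s : Q (set_reg s r (eval s e)) -> wp (Asg r e) Q s.
Proof. by eexists; first exact: exec_asg. Qed.

Lemma wp_put k a b Q s : Q (set_arr s k (eval s a) (eval s b)) -> wp (Put k a b) Q s.
Proof. by eexists; first exact: exec_put. Qed.

Lemma wp_seq a b Q s : wp a (wp b Q) s -> wp (Seq a b) Q s.
Proof. by case=> s1 e1 [s2 e2 Qs]; exists s2 => //; apply: exec_seq e1 e2. Qed.

Lemma wp_if e a b Q s :
  (if eval s e == 0 then wp b Q (tick s) else wp a Q (tick s)) -> wp (If e a b) Q s.
Proof.
case: eqP => [e0|/eqP e0] [s' ex Qs]; exists s' => //; first exact: exec_ifF.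
exact: exec_ifT.
Qed.

Lemma wp_while0 e a Q s : eval s e = 0 -> Q (tick s) -> wp (While e a) Q s.
Proof. by move=> e0 Qs; exists (tick s) => //; apply: exec_while0. Qed.

Lemma wp_whileS e a Q s :
  eval s e != 0 -> wp a (wp (While e a) Q) (tick s) -> wp (While e a) Q s.
Proof.
by move=> e0 [s1 e1 [s2 e2 Qs]]; exists s2 => //; apply: exec_whileS e0 e1 e2.
Qed.

Lemma wp_mono c (Q Q' : store -> Prop) s :
  wp c Q s -> (forall s', Q s' -> Q' s') -> wp c Q' s.
Proof. by case=> s' ex Qs QQ; exists s' => //; apply: QQ. Qed.

Fixpoint wregs (c : cmd) : seq nat :=
  match c with
  | Asg r _ => [:: r]
  | Seq a b | If _ a b => wregs a ++ wregs b
  | While _ a => wregs a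
  | _ => [::]
  end.

Fixpoint warrs (c : cmd) : seq nat :=
  match c with
  | Put k _ _ => [:: k]
  | Seq a b | If _ a b => warrs a ++ warrs b
  | While _ a => warrs a
  | _ => [::]
  end.

Definition agree (c : cmd) (s s' : store) : Prop :=
  (forall r, r \notin wregs c -> reg s' r = reg s r) /\
  (forall k, k \notin warrs c -> arr s' k = arr s k).

Lemma exec_agree c s s' : exec c s s' -> agree c s s'.
Proof.
elim=> {c s s'} /=.
- by [].
- by move=> s r e; split=> // r'; rewrite /= inE /upd => /negbTE->.
- by move=> s k a b; split=> // k'; rewrite /= inE => /negbTE->.
- move=> a b s s1 s2 _ [Ra Aa] _ [Rb Ab]; split=> x; rewrite /= mem_cat negb_or.
    by case/andP=> ? ?; rewrite Rb ?Ra.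
  by case/andP=> ? ?; rewrite Ab ?Aa.
- move=> e a b s s' _ _ [Ra Aa]; split=> x; rewrite /= mem_cat negb_or.
    by case/andP=> /Ra.
  by case/andP=> /Aa.
- move=> e a b s s' _ _ [Ra Aa]; split=> x; rewrite /= mem_cat negb_or.
    by case/andP=> _ /Ra.
  by case/andP=> _ /Aa.
- by [].
- move=> e a s s1 s2 _ _ [Ra Aa] _ [Rb Ab]; split=> x /= Hx.
    by rewrite Rb ?Ra.
  by rewrite Ab ?Aa.
Qed.

(** Supplies the frame, so that specifications need to mention only what a command changes. *)
Lemma wp_use c (Q Q' : store -> Prop) s : wp c Q s ->
  (forall s', agree c s s' -> Q s' -> Q' s') -> wp c Q' s.
Proof. by case=> s' ex Qs QQ; exists s' => //; apply: QQ => //; apply: exec_agree. Qed.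

Definition For (i b : nat) (body : cmd) : cmd :=
  Seq (Asg i (Cst 0))
    (While (Minus (Rg b) (Rg i)) (Seq body (Asg i (Plus (Rg i) (Cst 1))))).

(** An iteration costs two ticks beyond its body, for the test and the increment; the initialisation
    and the final test add two more. The linear clock bounds in the invariants below come from
    this. *)
Lemma wp_for i b body N (Inv : nat -> store -> Prop) (Q : store -> Prop) s :
  i != b -> i \notin wregs body -> b \notin wregs body -> reg s b = N ->
  Inv 0 (set_reg s i 0) ->
  (forall j s', j < N -> agree (For i b body) s s' -> reg s' i = j -> Inv j s' ->
     wp body (fun s2 => Inv j.+1 (set_reg s2 i j.+1)) (tick s')) ->
  (forall s', agree (For i b body) s s' -> Inv N s' -> Q (tick s')) ->
  wp (For i b body) Q s.
Proof.
move=> ib iw bw sb I0 IS IN; apply/wp_seq/wp_asg => /=.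
have bF : b \notin wregs (For i b body) by
  [rewrite /= inE mem_cat inE ![b == i]eq_sym !(negbTE ib) (negbTE bw)].
have AF : agree (For i b body) s (set_reg s i 0).
  by split=> // x; rewrite /= inE /upd; case: eqP.
suff loop k j s1 : N - j < k -> j <= N -> reg s1 i = j -> Inv j s1 ->
    agree (For i b body) s s1 ->
    wp (While (Minus (Rg b) (Rg i)) (Seq body (Asg i (Plus (Rg i) (Cst 1))))) Q s1.
  by apply: (loop N.+1 0) => //; [lia | rewrite /= /upd eqxx].
elim: k j s1 => // k IH j s1 kN jN i1 Ij AF1.
have b1 : reg s1 b = N by rewrite AF1.1.
move: jN; rewrite leq_eqVlt => /predU1P[jN|jN].
  apply: wp_while0; first by rewrite /= b1 i1 jN subnn.
  by apply: IN => //; rewrite -jN.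
apply: wp_whileS; rewrite /= ?b1 ?i1; first by rewrite subn_eq0 -ltnNge.
apply/wp_seq; apply: wp_use (IS j s1 jN AF1 i1 Ij) _ => s2 A2 I2; apply: wp_asg => /=.
have i2 : reg s2 i = j by rewrite A2.1.
rewrite i2 addn1; apply: (IH j.+1) => //; first lia.
  by rewrite /= /upd eqxx.
split=> x /= Hx.
  move: (Hx); rewrite inE mem_cat inE /upd; do ?case: eqP => //= _.
  by rewrite orbF => xb; rewrite A2.1 //= AF1.1.
by move: (Hx); rewrite cats0 => xb; rewrite A2.2 //= AF1.2.
Qed.

(** * Increasing chains of finite sets *)

Section Stabilisation.
Variables (T : finType) (f : nat -> {set T}).
Hypothesis f_sub : forall k, f k \subset f k.+1.
Hypothesis f_stop : forall k, f k = f k.+1 -> f k.+1 = f k.+2.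

Lemma chain_sub i j : i <= j -> f i \subset f j.
Proof.
move=> /subnK <-; elim: (j - i) => //= k IH.
exact: subset_trans IH (f_sub _).
Qed.

(** Until it stops, the chain gains an element at each step. This bounds both the useful radius of a
    ball and the number of rounds by [n]. *)
Lemma chain_stable k : #|T| <= k -> f k = f #|T|.
Proof.
have grow j : (j <= #|f j|) \/ f j = f j.+1.
  elim: j => [|j [IH|/f_stop]]; [by left | | by right].
  have [/f_stop|neq] := eqVneq (f j) (f j.+1); first by right.
  left; apply: leq_ltn_trans IH (proper_card _).
  by rewrite properEneq neq f_sub.
have stop : f #|T| = f #|T|.+1.
  case: (grow #|T|) => // full; apply/eqP; rewrite eqEsubset f_sub.
  have /eqP-> : f #|T| == setT by rewrite eqEcard subsetT cardsT.
  exact: subsetT.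
have stay j : f (j + #|T|) = f (j + #|T|).+1.
  by elim: j => //= j /f_stop.
move=> /subnK <-; elim: (k - #|T|) => // j IH.
by rewrite addSn -stay.
Qed.
End Stabilisation.

(** * Balls, ranks and separating sets *)

Section Graph.
Variables (n : nat) (e : rel 'I_n).
Implicit Types (S K : {set 'I_n}) (v w x : 'I_n) (p : seq 'I_n).

Lemma in_ballS S v k w : (w \in ball e S v k.+1) =
  (w \in ball e S v k) || (w \notin S) && [exists u in ball e S v k, e u w].
Proof. by rewrite /= !inE. Qed.

Lemma ball_sub S v i j : i <= j -> ball e S v i \subset ball e S v j.
Proof. by apply: chain_sub => k; apply: subsetUl. Qed.

Lemma ball_cap S v r : ball e S v (minn r n) = ball e S v r.
Proof.
have [//|rn] := leqP r n.
have := @chain_stable _ (ball e S v) (fun k => subsetUl _ _) _ r.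
rewrite card_ord => -> //; last exact: ltnW.
by move=> k E; rewrite [in LHS]/= E.
Qed.

Lemma ball_center S v k : v \in ball e S v k.
Proof. by apply: (subsetP (ball_sub S v (leq0n k))); rewrite inE. Qed.

Lemma ball_notin S v k w : w \in ball e S v k -> w != v -> w \notin S.
Proof.
elim: k => [|k IH]; first by rewrite inE => ->.
by rewrite in_ballS => /orP[/IH//|/andP[]].
Qed.

Lemma ranked_sub r m i j : i <= j -> ranked e r m i \subset ranked e r m j.
Proof. by apply: chain_sub => k; apply: subsetUl. Qed.

Lemma ranked_stable r m k : n <= k -> ranked e r m k = ranked e r m n.
Proof.
have := @chain_stable _ (ranked e r m) (fun k => subsetUl _ _) _ k.
by rewrite card_ord; apply=> j E; rewrite [in LHS]/= E.
Qed.

Lemma ranked_cap r m i : ranked e (minn r n) m i = ranked e r m i.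
Proof.
elim: i => //= i ->; congr (_ :|: _); apply/setP=> v; rewrite !inE; congr (_ && _).
by apply: eq_existsb => S; rewrite /nbhd ball_cap.
Qed.

Variables (r : nat) (v : 'I_n) (K : {set 'I_n}).

(** The rank test generalised for branching: [S] is already deleted and [d] more deletions are
    allowed. The test itself is the case [set0], [m]. *)
Definition separable S d : bool :=
  [exists S' : {set 'I_n}, [&& S \subset S', #|S'| <= #|S| + d, v \notin S'
                             & nbhd e r S' v :\ v \subset K]].

(** What a breadth-first path certifies: a set disjoint from [p] leaves the end of the path, a
    vertex outside [K], within reach. [v] is not in [p], as it may not be deleted. *)
Definition blocking S p : Prop :=
  [/\ size p <= r, {in p, forall x, x \notin S /\ x != v}
    & forall S', {in p, forall x, x \notin S'} -> ~~ (nbhd e r S' v :\ v \subset K)].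

Lemma separable_now S d : v \notin S -> nbhd e r S v :\ v \subset K -> separable S d.
Proof. by move=> vS sub; apply/existsP; exists S; rewrite vS sub leq_addr subxx. Qed.

Lemma blocking_separable0 S p : blocking S p -> separable S 0 = false.
Proof.
case=> _ pS block; apply/existsP=> -[S' /and4P[sub card vS ball_sub]].
have E : S = S' by apply/eqP; rewrite eqEcard sub -(addn0 #|S|).
by move: (block S'); rewrite ball_sub -E; case/(_ _)/negP=> // x /pS[].
Qed.

(** The branching rule: a separating superset of [S] must meet [p] in some [x], so it contains
    [x |: S] and has one deletion less to spend. *)
Lemma blocking_separableS S p d : blocking S p ->
  separable S d.+1 = has (fun x => separable (x |: S) d) p.
Proof.
case=> _ pS block; apply/idP/hasP.
  case/existsP=> S' /and4P[sub card vS ball_sub].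
  have [/hasP[x px xS']|] := boolP (has (fun x => x \in S') p).
    exists x => //; apply/existsP; exists S'; rewrite vS ball_sub subUset sub1set xS' sub.
    by rewrite /= cardsU1 (pS x px).1 andbT add1n addSnnS.
  by move=> /hasPn/block; rewrite ball_sub.
case=> x px /existsP[S' /and4P[sub card vS ball_sub]]; apply/existsP; exists S'.
rewrite vS ball_sub (subset_trans _ sub) ?subsetUr //= andbT.
by move: card; rewrite cardsU1 (pS x px).1 add1n addSnnS.
Qed.

Lemma in_rankedS m i : K = ranked e r m i ->
  (v \in ranked e r m i.+1) = (v \in K) || separable set0 m.
Proof.
move=> EK; rewrite /= -EK !inE; case: (v \in K) => //=; apply: eq_existsb => S.
by rewrite sub0set cards0.
Qed.

End Graph.

(* Upper bound for the number of search-tree nodes below a choice made when [s]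
   vertices are deleted and [d] further deletions are allowed: for [r = 1] the
   tree is a path, and its length is bounded by [n] rather than by [r ^ d]. *)
Definition tree_bound (r n d s : nat) : nat :=
  if r == 1 then n - s else 2 * r ^ d - 1.

(** For [r >= 2] the subtracted 1 closes the recursion: [1 + r * (2 * r ^ d - 1) <= 2 * r ^ d.+1 -
    1]. For [r = 1] there is at most one child, and [n - s] drops by one. *)
Lemma tree_boundS r n d s l : 0 < r -> s < n -> l <= r ->
  1 + l * tree_bound r n d s.+1 <= tree_bound r n d.+1 s.
Proof.
rewrite /tree_bound => r0 sn lr; case: eqP => [r1|r1].
  have : l * (n - s.+1) <= 1 * (n - s.+1) by rewrite leq_mul2r -r1 lr orbT.
  lia.
have : l * (2 * r ^ d - 1) <= r * (2 * r ^ d - 1) by rewrite leq_mul2r lr orbT.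
have : 0 < r ^ d by rewrite expn_gt0 r0.
have : 2 * r <= 2 * r * r ^ d by rewrite leq_pmulr // expn_gt0 r0.
rewrite expnS mulnBr muln1 mulnCA mulnA; lia.
Qed.

(** * The ranking program *)

Arguments upd M a x b /.

(* [rD]: deletions still allowed; [rF]: set once a separating set is found;
   [rT]: target of the path plus one, or 0; the BFS queue is [aQ] on [0, rQ),
   with current layer [rLo, rHi).  [aS] marks the deleted vertices, [aOk] the
   vertices to be ranked at the end of the round; [aP] holds the BFS parent plus
   one, or 0 if unvisited; [aRk] holds the rank, or 0 if still unranked; [aRow]
   holds the offsets of the rows of the matrix in [aIn]. *)
Notation rN := 0 (only parsing).
Notation rR := 1 (only parsing).
Notation rM := 2 (only parsing).
Notation rI := 3 (only parsing).
Notation rV := 4 (only parsing).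
Notation rD := 5 (only parsing).
Notation rSP := 6 (only parsing).
Notation rF := 7 (only parsing).
Notation rX := 8 (only parsing).
Notation rK := 9 (only parsing).
Notation rLo := 10 (only parsing).
Notation rHi := 11 (only parsing).
Notation rQ := 12 (only parsing).
Notation rU := 13 (only parsing).
Notation rW := 14 (only parsing).
Notation rRow := 15 (only parsing).
Notation rT := 16 (only parsing).

Notation aIn := 0 (only parsing).
Notation aRk := 1 (only parsing).
Notation aS := 2 (only parsing).
Notation aP := 3 (only parsing).
Notation aQ := 4 (only parsing).
Notation aSt := 5 (only parsing).
Notation aOk := 6 (only parsing).
Notation aRow := 7 (only parsing).

Infix ";;" := Seq (at level 60, right associativity).

(** Testing [aP] before the matrix keeps the search off the diagonal, since [rU] itself is already
    visited. *)
Definition scan : cmd :=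
  If (Get aP (Rg rW)) Skip
    (If (Get aS (Rg rW)) Skip
      (If (Get aIn (Plus (Rg rRow) (Rg rW)))
        (Put aP (Rg rW) (Plus (Rg rU) (Cst 1)) ;;
         Put aQ (Rg rQ) (Rg rW) ;;
         Asg rQ (Plus (Rg rQ) (Cst 1)))
        Skip)).

Definition expand : cmd :=
  Asg rU (Get aQ (Rg rLo)) ;;
  Asg rRow (Get aRow (Rg rU)) ;;
  For rW rN scan ;;
  Asg rLo (Plus (Rg rLo) (Cst 1)).

Definition layer : cmd :=
  Asg rHi (Rg rQ) ;; While (Minus (Rg rHi) (Rg rLo)) expand.

Definition bfs : cmd :=
  For rW rN (Put aP (Rg rW) (Cst 0)) ;;
  Put aP (Rg rV) (Cst 1) ;;
  Put aQ (Cst 0) (Rg rV) ;;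
  Asg rLo (Cst 0) ;;
  Asg rQ (Cst 1) ;;
  For rK rR layer.

(** The absolute difference: one of the two truncated subtractions is zero. *)
Definition neq_expr (a b : nat) : expr :=
  Plus (Minus (Rg a) (Rg b)) (Minus (Rg b) (Rg a)).

Definition find_target : cmd :=
  Asg rT (Cst 0) ;;
  For rW rN
    (If (Get aP (Rg rW))
      (If (Get aRk (Rg rW)) Skip
        (If (neq_expr rW rV) (Asg rT (Plus (Rg rW) (Cst 1))) Skip))
      Skip).

Definition push_path : cmd :=
  While (neq_expr rX rV)
    (Put aSt (Rg rSP) (Rg rX) ;;
     Asg rSP (Plus (Rg rSP) (Cst 1)) ;;
     Asg rX (Minus (Get aP (Rg rX)) (Cst 1))).

Definition node : cmd :=
  bfs ;;
  find_target ;;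
  If (Rg rT)
    (If (Rg rD) (Asg rX (Minus (Rg rT) (Cst 1)) ;; push_path) Skip)
    (Asg rF (Cst 1)).

(* The top of the stack is marked exactly when its subtree has been explored. *)
Definition dfs_step : cmd :=
  Asg rX (Get aSt (Minus (Rg rSP) (Cst 1))) ;;
  If (Get aS (Rg rX))
    (Put aS (Rg rX) (Cst 0) ;;
     Asg rSP (Minus (Rg rSP) (Cst 1)) ;;
     Asg rD (Plus (Rg rD) (Cst 1)))
    (Put aS (Rg rX) (Cst 1) ;;
     Asg rD (Minus (Rg rD) (Cst 1)) ;;
     node).

(** The loop does not stop once [rF] is set: emptying the stack also clears every mark in [aS], as
    the next search requires. *)
Definition search : cmd :=
  Asg rD (Rg rM) ;;
  Asg rSP (Cst 0) ;;
  Asg rF (Cst 0) ;;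
  node ;;
  While (Rg rSP) dfs_step.

(** Verdicts are collected in [aOk] and written to [aRk] only afterwards, because a round checks all
    vertices simultaneously. *)
Definition round : cmd :=
  For rV rN
    (If (Get aRk (Rg rV)) Skip (search ;; Put aOk (Rg rV) (Rg rF))) ;;
  For rV rN
    (If (Get aRk (Rg rV)) Skip
      (If (Get aOk (Rg rV)) (Put aRk (Rg rV) (Plus (Rg rI) (Cst 1))) Skip)).

(** * Correctness and cost of one search node *)

Section Verification.
Variables (n : nat) (e : rel 'I_n) (r : nat) (v : 'I_n) (K : {set 'I_n}).
Implicit Types (S : {set 'I_n}) (u w x : 'I_n) (q p : seq 'I_n) (s : store).

(** Nothing is claimed on the diagonal, where cells get overwritten when the program starts. *)
Definition graph_at s : Prop :=
  [/\ reg s rN = n, reg s rR = r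
    & forall u w, u != w -> arr s aIn (arr s aRow u + w) = e u w].

Definition ranks_at s : Prop := forall w, (arr s aRk w == 0) = (w \notin K).

Definition marks S s : Prop := forall w, arr s aS w = (w \in S).

Lemma graph_at_agree c s s' : agree c s s' ->
  (rN \notin wregs c) && (rR \notin wregs c) ->
  (aIn \notin warrs c) && (aRow \notin warrs c) -> graph_at s -> graph_at s'.
Proof.
move=> [Ar Aa] /andP[? ?] /andP[? ?] [g1 g2 g3]; split; rewrite ?Ar //.
by move=> u w uw; rewrite !Aa //; apply: g3.
Qed.

Lemma marks_agree S c s s' : agree c s s' -> aS \notin warrs c ->
  marks S s -> marks S s'.
Proof. by move=> [_ Aa] cS mk w; rewrite Aa. Qed.

Lemma ranks_at_agree c s s' : agree c s s' -> aRk \notin warrs c ->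
  ranks_at s -> ranks_at s'.
Proof. by move=> [_ Aa] cS rk w; rewrite Aa. Qed.

Section Bfs.
Variable (S : {set 'I_n}).
Local Notation B := (ball e S v).

(** Ranging over all [j] says that a parent is one layer closer to [v], without a distance
    function. *)
Definition parents q s : Prop := forall j w, w \in q -> w != v -> w \in B j.+1 ->
  exists u, [/\ arr s aP w = u.+1, u \in B j & e u w].

(** [D] is the set of pairs scanned so far; the lemmas on [scan], [expand] and [layer] differ in how
    it grows. *)
Definition bfs_inv k q (D : 'I_n -> 'I_n -> Prop) s : Prop :=
  [/\ mkseq (arr s aQ) (reg s rQ) = map val q, uniq q,
      forall w, (arr s aP w == 0) = (w \notin q) & parents q s] /\
  [/\ {subset q <= B k.+1}, {subset B k <= q}
    & forall u w, D u w -> e u w -> w \notin S -> w \in q].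

Lemma bfs_inv_weaken k q (D D' : 'I_n -> 'I_n -> Prop) s :
  (forall u w, D' u w -> e u w -> w \notin S -> D u w \/ w \in q) ->
  bfs_inv k q D s -> bfs_inv k q D' s.
Proof.
move=> DD [? [? ? D1]]; split=> //; split=> // u w D'u euw wS.
by case: (DD u w) => // /D1; apply.
Qed.

Lemma scan_spec k q0 q D u (j : nat) s : graph_at s -> marks S s -> j < n ->
  reg s rU = u -> reg s rRow = arr s aRow u -> reg s rW = j ->
  u \in B k -> prefix q0 q ->
  bfs_inv k q (fun u' w => D u' w \/ u' = u /\ w < j) s ->
  wp scan (fun s' => clk s' <= clk s + 6 /\ exists2 q', prefix q0 q' &
    bfs_inv k q' (fun u' w => D u' w \/ u' = u /\ w < j.+1) s') s.
Proof.
move=> [_ _ mat] mk jn sU sRow sW uB pre inv.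
pose w := Ordinal jn.
have Ew : j = w by [].
have split_lt w' : w' < j.+1 -> w' < j \/ w' = w.
  by rewrite ltnS leq_eqVlt => /predU1P[E|]; [right; apply: val_inj | left].
have skip s' : arr s' =  arr s -> reg s' rQ = reg s rQ ->
   clk s' <= clk s + 6 -> [|| w \in q, ~~ e u w | w \in S] ->
   clk s' <= clk s + 6 /\ exists2 q', prefix q0 q' &
    bfs_inv k q' (fun u' w => D u' w \/ u' = u /\ w < j.+1) s'.
  move=> Ea Er Hc Hw; split=> //; exists q => //.
  have {}inv : bfs_inv k q (fun u' w => D u' w \/ u' = u /\ w < j) s'.
    by rewrite /bfs_inv /parents Ea Er.
  apply: bfs_inv_weaken inv => u' w' [|[-> /split_lt[]]]; [by left; left|by left; right|].
  move=> -> euw wS; right; move: Hw; rewrite euw (negbTE wS).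
  by rewrite /= !orbF.
case: (inv) => [[Eq uq vis par] [qB Bq closed]].
apply/wp_if => /=; rewrite sW Ew vis; case: ifPn => [wq|]; last first.
  by rewrite negbK => wq; apply/wp_skip/skip; rewrite /= ?wq //; lia.
apply/wp_if => /=; rewrite sW Ew mk eqb0; case: ifPn => [wS|]; last first.
  by rewrite negbK => wS; apply/wp_skip/skip; rewrite /= ?wS ?orbT //; lia.
(* [u] is already queued and [w] is not, so the matrix is read off the diagonal. *)
have uw : u != w by apply: contraNneq wq => <-; apply: Bq.
apply/wp_if => /=; rewrite sW sRow Ew mat // eqb0; case: ifPn => [ew|].
  by apply/wp_skip/skip; rewrite /= ?ew ?orbT //; lia.
rewrite negbK => euw.
have wB1 : w \in B k.+1 by rewrite in_ballS wS; apply/orP; right; apply/exists_inP; exists u.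
have wv : w != v by apply: contraNneq wq => ->; apply/Bq/ball_center.
have sQ : reg s rQ = size q by rewrite -(size_map val q) -Eq size_mkseq.
apply/wp_seq/wp_put => /=; apply/wp_seq/wp_put => /=; apply/wp_asg; split; first by rewrite /=; lia.
exists (rcons q w); first by rewrite -cats1; apply: prefix_trans pre (prefix_prefix _ _).
split; split.
- rewrite /= addn1 mkseqS map_rcons -Eq /= eqxx sW; congr rcons.
  apply/eq_in_map => i; rewrite mem_iota add0n => /andP[_ Hi] /=.
  by case: eqP => // E; move: Hi; rewrite E ltnn.
- by rewrite rcons_uniq wq.
- move=> w'; rewrite /= sW sU mem_rcons inE negb_or.
  case: (eqVneq w' w) => [->|neq]; first by rewrite eqxx addn1.
  by rewrite ifN ?vis.
- move=> l w' /=; rewrite mem_rcons inE sW sU; case: eqVneq => [->|neq] /=.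
    move=> _ _ wl; rewrite eqxx addn1; exists u; split=> //.
    (* A new vertex lies outside [B k], so any ball [B l.+1] containing it has [k <= l], and [u] is
       in [B l]. *)
    have [kl|lk] := leqP k l; first exact: (subsetP (ball_sub e S v kl)).
    by case/negP: wq; apply/Bq/(subsetP (ball_sub e S v lk)).
  by rewrite ifN //; apply: par.
- by move=> w'; rewrite mem_rcons inE => /predU1P[->//|/qB].
- by move=> w' /Bq; rewrite mem_rcons inE orbC => ->.
- move=> u' w' H eu wS'; rewrite mem_rcons inE.
  case: H => [Du|[E /split_lt[lt|->]]]; last by rewrite eqxx.
    by rewrite (closed u' w') ?orbT //; left.
  by rewrite (closed u' w') ?orbT //; right.
Qed.

Lemma expand_spec k q0 q i s : graph_at s -> marks S s -> reg s rLo = i ->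
  i < size q0 -> prefix q0 q -> {subset q0 <= B k} ->
  bfs_inv k q (fun u _ => u \in take i q0) s ->
  wp expand (fun s' => [/\ clk s' <= clk s + (8 * n + 5), reg s' rLo = i.+1
    & exists2 q', prefix q0 q' & bfs_inv k q' (fun u _ => u \in take i.+1 q0) s']) s.
Proof.
move=> gr mk sLo iq pre q0B inv.
pose u := nth v q0 i.
have Eu : arr s aQ i = u.
  case: (inv) => -[Eq _ _ _] _; have [t Et] := prefixP pre.
  have iq' : i < size q by rewrite Et size_cat; lia.
  have Q : reg s rQ = size q by rewrite -(size_map val q) -Eq size_mkseq.
  rewrite -(nth_mkseq 0 (arr s aQ) (n := reg s rQ)) ?Q // -Q Eq (nth_map v) //.
  by rewrite Et nth_cat iq.
apply/wp_seq/wp_asg/wp_seq/wp_asg => /=; rewrite sLo Eu.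
set s1 := set_reg _ _ _.
apply/wp_seq/(wp_for (N := n) (Inv := fun j s' => clk s' <= clk s + 3 + 8 * j /\
  exists2 q', prefix q0 q' &
    bfs_inv k q' (fun u' w => u' \in take i q0 \/ u' = u /\ w < j) s')) => //.
- by case: gr.
- split; first by rewrite /=; lia.
  by exists q => //; apply: bfs_inv_weaken inv => u' w [|[]] //; left.
- move=> j s' jn A sj [clks [q' pre' inv']]; have [Ar Aa] := A.
  apply: wp_mono (scan_spec (u := u) (s := tick s') _ _ jn _ _ _ _ pre' inv') _ => //.
  + exact: (graph_at_agree A).
  + exact: (marks_agree A).
  + by rewrite [LHS]Ar.
  + by rewrite [LHS]Ar //= Aa.
  + exact/q0B/mem_nth.
  + move=> s2 [c2 [q2 pre2 inv2]]; split; last by exists q2.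
    by move: c2 clks => /=; lia.
- move=> s' [Ar Aa] [clks [q' pre' inv']].
  apply/wp_asg; split => /=; [lia | by rewrite Ar //= sLo addn1 |].
  exists q' => //; apply: bfs_inv_weaken inv' => u' w.
  rewrite (take_nth v iq) mem_rcons inE => /predU1P[->|H] _ _; left; last by left.
  by right.
Qed.

Lemma frontier_spec k q0 c : {subset q0 <= B k} -> forall q i s,
  size q0 - i = c -> i <= size q0 -> graph_at s -> marks S s ->
  reg s rLo = i -> reg s rHi = size q0 ->  prefix q0 q ->
  bfs_inv k q (fun u _ => u \in take i q0) s ->
  wp (While (Minus (Rg rHi) (Rg rLo)) expand)
   (fun s' => [/\ clk s' <= clk s + (8 * n + 6) * c + 1, reg s' rLo = size q0
    & exists2 q', prefix q0 q' & bfs_inv k q' (fun u _ => u \in q0) s']) s.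
Proof.
move=> q0B; elim: c => [|c IH] q i s Ec iq gr mk sLo sHi pre inv.
  apply: wp_while0; first by rewrite /= sLo sHi.
  have E : i = size q0 by lia.
  split=> //=; [lia | by rewrite sLo|].
  by exists q => //; move: inv; rewrite E take_size.
apply: wp_whileS; first by rewrite /= sLo sHi Ec.
have iq' : i < size q0 by lia.
apply: (wp_use (expand_spec (s := tick s) gr mk sLo iq' pre q0B inv)).
move=> s1 A [c1 lo1 [q1 pre1 inv1]].
apply: wp_mono (IH q1 i.+1 s1 _ _ _ _ _ _ pre1 inv1) _ => //.
- lia.
- exact: (graph_at_agree A).
- exact: (marks_agree A).
- by rewrite A.1.
- by move=> s' [c' ? ?]; split=> //; move: c1 c' => /=; lia.
Qed.

Lemma layer_spec k q i s : graph_at s -> marks S s -> reg s rLo = i ->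
  i <= size q -> {subset q <= B k} -> bfs_inv k q (fun u _ => u \in take i q) s ->
  wp layer (fun s' => [/\ clk s' <= clk s + (8 * n + 6) * (size q - i) + 2,
     reg s' rLo = size q
    & exists q', [/\ prefix q q', {subset q' <= B k.+1}
      & bfs_inv k.+1 q' (fun u _ => u \in take (size q) q') s']]) s.
Proof.
move=> gr mk sLo iq qB inv; apply/wp_seq/wp_asg => /=.
have Q : reg s rQ = size q.
  by case: inv => -[Eq _ _ _] _; rewrite -(size_map val q) -Eq size_mkseq.
apply: wp_mono (frontier_spec (q := q) (k := k) (i := i) qB (erefl _) iq _ _ _ _ _ _) _ => //.
  exact: prefix_refl.
move=> s' [c' lo' [q' pre [[Eq uq vis par] [q'B Bq' closed]]]].
split=> //; first by move: c' => /=; lia.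
exists q'; split=> //.
have [t Et] := prefixP pre; split; split=> //.
- by move=> w /q'B; apply/subsetP/ball_sub.
- move=> w; rewrite in_ballS => /orP[/Bq'//|/andP[wS /exists_inP[u uB uw]]].
  by apply: (closed u) => //; case: inv => _ [_ Bq _]; apply: Bq.
- by move=> u w Hu; apply: closed; move: Hu; rewrite Et take_size_cat.
Qed.

(** Every vertex is expanded at most once, at cost [8 * n + 6], and for [r = 1] only [v] is
    expanded. The [7 * n] is [3 * n] for clearing [aP] and 4 per layer. *)
Definition bfs_cost : nat := 7 * n + 8 + (8 * n + 6) * (if r == 1 then 1 else n).

Lemma bfs_spec s : 0 < r <= n -> graph_at s -> reg s rV = v -> marks S s ->
  wp bfs (fun s' => clk s' <= clk s + bfs_cost /\
    exists q, [/\ q =i B r, forall w, (arr s' aP w == 0) = (w \notin q)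
                & parents q s']) s.
Proof.
move=> /andP[r0 rn] gr sV mk.
apply/wp_seq/(wp_for (N := n) (Inv := fun j s' => clk s' <= clk s + 1 + 3 * j /\
  forall w, w < j -> arr s' aP w = 0)) => //.
- by case: gr.
- by split=> //=; lia.
- move=> j s' jn [Ar Aa] sj [c' z]; apply/wp_put; split; first by move: c' => /=; lia.
  by move=> w; rewrite /= sj ltnS leq_eqVlt; case: eqP => //= _ /z.
move=> s1 A1 [c1 z1]; have [Ar1 Aa1] := A1.
do 4![apply/wp_seq; (apply/wp_put || apply/wp_asg)] => /=.
rewrite Ar1 // sV; set s2 := set_reg _ _ _.
have c2 : clk s2 = clk s1 + 5 by rewrite /=; lia.
have s2R : reg s2 rR = r by rewrite /= Ar1 //; case: gr.
(* [i] counts expanded vertices. The clauses for small [k] serve the case [r = 1]: layer 0 is [v]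
   alone. *)
apply: (wp_for (N := r) (Inv := fun k s' => exists q i,
  [/\ reg s' rLo = i, i <= size q, k <= 1 -> i <= k & k = 0 -> size q = 1] /\
  [/\ {subset q <= B k}, bfs_inv k q (fun u _ => u \in take i q) s'
    & clk s' <= clk s2 + 1 + 4 * k + (8 * n + 6) * i])) => //.
- exists [:: v], 0; split=> //; split=> //; last by rewrite /=; lia.
    by move=> w; rewrite !inE.
  split; split=> //.
  + move=> w; rewrite /= inE; have [->|wv] := eqVneq w v; first by rewrite eqxx.
    by rewrite ifN // z1.
  + by move=> j w; rewrite inE => /eqP->; rewrite eqxx.
  + by move=> w; rewrite inE => /eqP->; apply: ball_center.
  + by move=> w; rewrite !inE.
- move=> k s' kr A sk [q [i [[sLo iq i1 k0] [qB inv clks]]]].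
  apply: wp_mono (layer_spec (s := tick s') _ _ sLo iq qB inv) _.
  + exact: graph_at_agree A _ _ (graph_at_agree A1 _ _ gr).
  + exact: marks_agree A _ (marks_agree A1 _ mk).
  + move=> s3 [c3 lo3 [q' [pre q'B inv']]]; exists q', (size q).
    split; split=> //.
    * by have [t ->] := prefixP pre; rewrite size_cat leq_addr.
    * by move=> k1; rewrite k0 //; lia.
    * move: c3 clks => /=; rewrite mulnBr.
      have : (8 * n + 6) * i <= (8 * n + 6) * size q by rewrite leq_mul2l iq orbT.
      lia.
- move=> s3 _ [q [i [[sLo iq i1 k0] [qB [[Eq uq vis par] [_ Bq _]] clks]]]].
  split; last first.
    exists q; split=> // w; apply/idP/idP; [exact: qB | exact: Bq].
  have qn : size q <= n by rewrite -(card_uniqP uq) -[X in _ <= X]card_ord max_card.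
  have iB : i <= (if r == 1 then 1 else n).
    by case: eqP => [r1|_]; [move: i1; rewrite r1; apply | lia].
  have : (8 * n + 6) * i <= (8 * n + 6) * (if r == 1 then 1 else n).
    by rewrite leq_mul2l iB orbT.
  rewrite /bfs_cost; move: clks c2 c1 => /=; lia.
Qed.

Lemma find_target_spec q s : reg s rN = n -> reg s rV = v -> ranks_at s ->
  (forall w, (arr s aP w == 0) = (w \notin q)) ->
  wp find_target (fun s' => clk s' <= clk s + 6 * n + 3 /\
    (reg s' rT = 0 /\ {in q, forall w, w != v -> w \in K} \/
     exists w, [/\ reg s' rT = w.+1, w \in q, w != v & w \notin K])) s.
Proof.
move=> sN sV rk vis; apply/wp_seq/wp_asg => /=.
pose found j s' := reg s' rT = 0 /\ {in q, forall w, w < j -> w != v -> w \in K} \/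
     exists w, [/\ reg s' rT = w.+1, w \in q, w != v & w \notin K].
apply/(wp_for (N := n)
  (Inv := fun j s' => clk s' <= clk s + 2 + 6 * j /\ found j s')) => //.
- by split; [move=> /=; lia | left].
- move=> j s' jn A sj [c' fd]; have [Ar Aa] := A; pose w := Ordinal jn.
  have keep s2 : reg s2 rT = reg s' rT ->
      (w \in q -> w != v -> w \in K) -> found j.+1 s2.
    rewrite /found => -> wK; case: fd => [[t0 IH]|]; [left | by right].
    split=> // w' w'q; rewrite ltnS leq_eqVlt => /predU1P[E|]; last exact: IH.
    by have ww : w' = w by [apply: val_inj]; rewrite ww in w'q *; apply: wK.
  have Ew : j = w by [].
  apply/wp_if => /=; rewrite sj Aa //= Ew vis; case: ifPn => wq.
    apply/wp_skip; split; first by move: c' => /=; lia.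
    by apply: keep => // wq'; case/negP: wq.
  apply/wp_if => /=; rewrite sj Aa //= Ew rk; case: ifPn => wK; last first.
    apply/wp_skip; split; first by move: c' => /=; lia.
    by apply: keep => //; rewrite negbK in wK.
  apply/wp_if => /=; rewrite sj Ar //= sV; case: eqP => wv.
    apply/wp_skip; split; first by move: c' => /=; lia.
    by apply: keep => // _ /eqP[]; apply: val_inj => /=; lia.
  apply/wp_asg; split; first by move: c' => /=; lia.
  right; exists w; rewrite /= sj addn1; split=> //; first by rewrite negbK in wq.
  by apply: contra_not_neq wv => <-; rewrite /= subnn.
- move=> s' _ [c' fd]; split; first by move: c' => /=; lia.
  case: fd => [[t0 H]|[w Hw]]; [left | by right; exists w].
  by split=> // w wq; apply: H.
Qed.

Definition stack s : seq nat := mkseq (arr s aSt) (reg s rSP).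

Lemma stack_push s (x : nat) s' : reg s' rSP = (reg s rSP).+1 ->
  (forall i, arr s' aSt i = if i == reg s rSP then x else arr s aSt i) ->
  stack s' = rcons (stack s) x.
Proof.
move=> Er Ea; rewrite /stack Er mkseqS Ea eqxx; congr rcons.
apply/eq_in_map => i; rewrite mem_iota add0n => /andP[_ Hi].
by rewrite Ea; case: eqP => // E; move: Hi; rewrite E ltnn.
Qed.

(** Each parent step lowers the radius [j] by one. The pushed vertices form a path back to [v],
    which survives in [G - S'] whenever [S'] avoids them. *)
Lemma push_path_spec q j : q =i B r -> j <= r -> forall x s,
  parents q s -> reg s rV = v -> reg s rX = x -> x \in B j ->
  wp push_path (fun s' => clk s' <= clk s + 4 * j + 1 /\
    exists p, [/\ size p <= j, {in p, forall y, y \notin S /\ y != v},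
      forall S', {in p, forall y, y \notin S'} -> x \in ball e S' v j
    & stack s' = stack s ++ map val p]) s.
Proof.
move=> qB; elim: j => [|j IH] jr x s par sV sX xB.
  have xv : x = v by apply/set1P.
  apply: wp_while0; first by rewrite /= sX sV xv subnn.
  split; first by rewrite /=; lia.
  by exists [::]; split=> //; rewrite cats0.
have [xv|xv] := eqVneq x v.
  apply: wp_while0; first by rewrite /= sX sV xv subnn.
  split; first by rewrite /=; lia.
  exists [::]; split=> // [S' _|]; first by rewrite xv ball_center.
  by rewrite cats0.
apply: wp_whileS.
  by rewrite /= sX sV; apply: contra_neq xv => H; apply: val_inj => /=; lia.
have xq : x \in q by rewrite qB (subsetP (ball_sub e S v jr)).
have [u [Pu uB ux]] := par j x xq xv xB.
apply/wp_seq/wp_put/wp_seq/wp_asg/wp_asg => /=; rewrite sX Pu subn1 /=.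
set s1 := set_reg _ rX _.
apply: wp_mono (IH (ltnW jr) u s1 _ _ _ uB) _ => //.
move=> s' [c' [p [sp pS pB Est]]]; split; first by move: c' => /=; lia.
exists (x :: p); split=> //.
- move=> y; rewrite inE => /predU1P[->|/pS//]; split=> //.
  exact: ball_notin xB xv.
- move=> S' Hp; rewrite in_ballS Hp ?mem_head //=; apply/orP; right.
  apply/exists_inP; exists u => //; apply: pB => y yp.
  by apply: Hp; rewrite inE yp orbT.
- by rewrite Est (@stack_push s x s1) ?cat_rcons //= addn1.
Qed.

Definition node_cost : nat := bfs_cost + 10 * n + 10.

(** [b] tells whether [S] already separates, and [p] lists the branches. With no deletion left [p]
    is empty, so the value of [0.-1] is harmless. *)
Lemma node_spec s : 0 < r <= n -> graph_at s -> ranks_at s -> reg s rV = v ->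
  v \notin S -> marks S s ->
  wp node (fun s' => clk s' <= clk s + node_cost /\
    exists b p, [/\ reg s' rF = (if b then 1 else reg s rF),
      stack s' = stack s ++ map val p,
      size p <= r /\ {in p, forall y, y \notin S /\ y != v},
      reg s rD = 0 -> p = [::]
    & separable e r v K S (reg s rD) =
        b || has (fun y => separable e r v K (y |: S) (reg s rD).-1) p]) s.
Proof.
move=> rn gr rk sV vS mk.
apply/wp_seq; apply: wp_use (bfs_spec rn gr sV mk) _ => s1 A1 [c1 [q [qB vis par]]].
have [Ar1 Aa1] := A1; apply/wp_seq.
have sN : reg s1 rN = n by rewrite Ar1 //; case: gr.
have sV1 : reg s1 rV = v by rewrite Ar1.
apply: wp_use (find_target_spec sN sV1 (ranks_at_agree A1 _ rk) vis) _ => // s2 A2 [c2 fd].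
have [Ar2 Aa2] := A2.
have D2 : reg s2 rD = reg s rD by rewrite Ar2 // Ar1.
have F2 : reg s2 rF = reg s rF by rewrite Ar2 // Ar1.
have Est : stack s2 = stack s by rewrite /stack Ar2 // Ar1 // Aa2 // Aa1.
rewrite /node_cost; apply/wp_if => /=; case: fd => [[-> H]|[w [Tw wq wv wK]]]; last rewrite Tw /=.
  apply/wp_asg; split; first by move=> /=; lia.
  exists true, [::]; split=> //; first by rewrite cats0.
  rewrite /= separable_now //; apply/subsetP => w; rewrite !inE -qB => /andP[wv wq].
  exact: H.
have wB : w \in B r by rewrite -qB.
have not_now p : {in p, forall y, y \notin S /\ y != v} -> size p <= r ->
   (forall S', {in p, forall y, y \notin S'} -> w \in ball e S' v r) ->
   blocking e r v K S p.
  move=> pS sp pB; split=> // S' /pB wS'; apply/negP=> /subsetP/(_ w).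
  by rewrite !inE wv wS' (negbTE wK) => /(_ isT).
have sX : reg (set_reg (tick (tick s2)) rX w) rX = w by [].
have par2 : parents q (set_reg (tick (tick s2)) rX w).
  by move=> j x; rewrite /= Aa2 //; apply: par.
have sV2 : reg (set_reg (tick (tick s2)) rX w) rV = v by rewrite /= Ar2.
(* This run is considered before the test of [rD]: with no deletion left the program skips it, but
   its path still proves that [S] cannot be completed. *)
have [s3 ex3 [c3 [p [sp pS pB Est3]]]] :=
  push_path_spec qB (leqnn r) par2 sV2 sX wB.
have blk := not_now p pS sp pB.
apply/wp_if => /=; rewrite D2; case: eqP => [d0|dpos].
  apply/wp_skip; split; first by move=> /=; lia.
  exists false, [::]; split=> //=; first by rewrite cats0.
  by rewrite d0 (blocking_separable0 blk).
apply/wp_seq/wp_asg => /=; rewrite Tw subn1 /=.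
exists s3; last first.
  split; first by move: c3 => /=; case/andP: rn => ? ?; lia.
  exists false, p; split=> //=.
  - by rewrite (exec_agree ex3).1.
  - by rewrite Est3 -Est.
  - by rewrite -(blocking_separableS _ blk) prednK //; lia.
by [].
Qed.

End Bfs.
End Verification.

(** * The depth-first search over deleted sets *)

Section Search.
Variables (n : nat) (e : rel 'I_n) (r m : nat) (v : 'I_n) (K : {set 'I_n}).
Hypothesis rn : 0 < r <= n.
Implicit Types (S : {set 'I_n}) (x : 'I_n) (p stk : seq 'I_n) (s : store).

Local Notation sep := (separable e r v K).

Definition dfs_at S d (f : bool) stk s : Prop :=
  [/\ graph_at e r s, ranks_at K s & reg s rV = v] /\
  [/\ marks S s, reg s rD = d, reg s rF = f & stack s = map val stk].

(** Besides [node_cost], 5 ticks for entering a node and 6 for leaving it. *)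
Definition visit_cost : nat := node_cost n r + 11.

Lemma stack_size S d f stk s : dfs_at S d f stk s -> reg s rSP = size stk.
Proof. by case=> _ [_ _ _ Est]; rewrite -(size_map val stk) -Est size_mkseq. Qed.

Lemma stack_top S d f stk x s : dfs_at S d f (rcons stk x) s ->
  arr s aSt (reg s rSP - 1) = x.
Proof.
move=> D; have E := stack_size D; case: D => _ [_ _ _ Est].
have := congr1 (nth 0 ^~ (size stk)) Est.
by rewrite /stack E size_rcons nth_mkseq // map_rcons nth_rcons size_map ltnn eqxx subn1.
Qed.

Lemma visit S d f stk x s (Q : store -> Prop) :
  v \notin S -> x \notin S -> x != v -> dfs_at S d.+1 f (rcons stk x) s ->
  (forall s' b p, dfs_at (x |: S) d (f || b) (rcons stk x ++ p) s' ->
     clk s' <= clk s + node_cost n r + 5 ->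
     size p <= r -> {in p, forall y, y \notin x |: S /\ y != v} ->
     (d = 0 -> p = [::]) ->
     sep (x |: S) d = b || has (fun y => sep (y |: (x |: S)) d.-1) p ->
     wp (While (Rg rSP) dfs_step) Q s') ->
  wp (While (Rg rSP) dfs_step) Q s.
Proof.
move=> vS xS xv D post; have top := stack_top D; have size_st := stack_size D.
case: D => [[gr rk sV] [mk sD sF Est]].
apply: wp_whileS; first by rewrite /= size_st size_rcons.
apply/wp_seq/wp_asg => /=; rewrite top.
apply/wp_if => /=; rewrite mk (negbTE xS) eqxx.
apply/wp_seq/wp_put/wp_seq/wp_asg => /=; rewrite sD subn1 /=.
set s1 := set_reg _ rD _.
have vS1 : v \notin x |: S by rewrite !inE negb_or eq_sym xv.
have mk1 : marks (x |: S) s1.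
  move=> w; rewrite /= !inE; have [->|wx] := eqVneq w x; first by rewrite eqxx.
  by rewrite ifN // mk.
apply: wp_use (node_spec (s := s1) rn gr rk sV vS1 mk1) _.
move=> s' A [c' [b [p [F' st' [sp pS] p0 sepE]]]].
apply: (post s' b p) => //; last by move: c' => /=; lia.
split; split.
- exact: (graph_at_agree A).
- exact: (ranks_at_agree A).
- by rewrite A.1.
- exact: (marks_agree A).
- by rewrite A.1.
- by rewrite F' /= sF; case: (b); rewrite ?orbT ?orbF.
- by rewrite st' map_cat -Est.
Qed.

Lemma backtrack S d f stk x s (Q : store -> Prop) :
  x \notin S -> dfs_at (x |: S) d f (rcons stk x) s ->
  (forall s', dfs_at S d.+1 f stk s' -> clk s' <= clk s + 6 ->
     wp (While (Rg rSP) dfs_step) Q s') ->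
  wp (While (Rg rSP) dfs_step) Q s.
Proof.
move=> xS D post; have top := stack_top D; have size_st := stack_size D.
case: D => [[gr rk sV] [mk sD sF Est]].
apply: wp_whileS; first by rewrite /= size_st size_rcons.
apply/wp_seq/wp_asg => /=; rewrite top.
apply/wp_if => /=; rewrite mk !inE eqxx /=.
apply/wp_seq/wp_put/wp_seq/wp_asg/wp_asg/post => /=; last by lia.
split; split=> //=.
- move=> w; rewrite /=; have [->|wx] := eqVneq w x; first by rewrite eqxx (negbTE xS).
  by rewrite ifN // mk !inE (negbTE wx).
- by rewrite sD addn1.
- move: Est; rewrite /stack /= size_st size_rcons subn1 /= mkseqS map_rcons.
  by case/rcons_inj.
Qed.

(** Continuation style: the end of a subtree is no syntactic boundary in the loop, so the hypothesis
    describes the store from which the same loop continues, for any [Q]. *)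
Definition explores d : Prop := forall S (f : bool) stk x s (Q : store -> Prop),
  v \notin S -> x \notin S -> x != v ->
  dfs_at S d.+1 f (rcons stk x) s ->
  (forall s', dfs_at S d.+1 (f || sep (x |: S) d) stk s' ->
     clk s' <= clk s + visit_cost * tree_bound r n d #|S| ->
     wp (While (Rg rSP) dfs_step) Q s') ->
  wp (While (Rg rSP) dfs_step) Q s.

(** Siblings are popped from the last to the first, and each leaves [S] and [d] as it found them. *)
Lemma explore_list d : explores d -> forall p S (f : bool) stk s (Q : store -> Prop),
  v \notin S -> {in p, forall y, y \notin S /\ y != v} ->
  dfs_at S d.+1 f (stk ++ p) s ->
  (forall s', dfs_at S d.+1 (f || has (fun y => sep (y |: S) d) p) stk s' ->
     clk s' <= clk s + visit_cost * (size p * tree_bound r n d #|S|) ->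
     wp (While (Rg rSP) dfs_step) Q s') ->
  wp (While (Rg rSP) dfs_step) Q s.
Proof.
move=> expl; elim/last_ind=> [|p x IH] S f stk s Q vS pS D post.
  by apply: post; rewrite ?orbF; [rewrite cats0 in D | rewrite leq_addr].
have [xS xv] : x \notin S /\ x != v by apply: pS; rewrite mem_rcons mem_head.
rewrite -rcons_cat in D; apply: (expl _ _ _ _ _ _ vS xS xv D) => s1 D1 c1.
apply: (IH _ _ _ _ _ vS _ D1) => [y yp|s2 D2 c2].
  by apply: pS; rewrite mem_rcons inE yp orbT.
apply: post; first by rewrite has_rcons orbA.
apply: leq_trans c2 _; rewrite size_rcons mulSn mulnDr addnA; exact: leq_add.
Qed.

Lemma explore d : explores d.
Proof.
elim: d => [|d IH] S f stk x s Q vS xS xv D post;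
  (apply: (visit vS xS xv D) => s1 b p D1 c1 sp pS p0 sepE);
  (* [x] is not in [S], so [S] is not the whole vertex set and [n - #|S|] is positive. *)
  have Sn : #|S| < n by
    [rewrite -[X in _ < X]card_ord -cardsT; apply: proper_card;
     rewrite properT; apply: contraNneq xS => ->; rewrite inE].
  rewrite p0 // cats0 in D1; apply: (backtrack xS D1) => s2 D2 c2.
  rewrite p0 // orbF in sepE; apply: post; first by rewrite sepE.
  have : visit_cost * 1 <= visit_cost * tree_bound r n 0 #|S|.
    by rewrite leq_mul2l /tree_bound expn0 muln1; case: ifP; lia.
  by rewrite {1}/visit_cost; lia.
have vS1 : v \notin x |: S by rewrite !inE negb_or eq_sym xv.
apply: (explore_list IH vS1 pS D1) => s2 D2 c2.
apply: (backtrack xS D2) => s3 D3 c3.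
apply: post; first by rewrite sepE orbA.
case/andP: (rn) => r0 _.
have : visit_cost * (1 + size p * tree_bound r n d #|S|.+1) <=
       visit_cost * tree_bound r n d.+1 #|S|.
  by rewrite leq_mul2l tree_boundS ?orbT.
have cS : #|x |: S| = #|S|.+1 by rewrite cardsU1 xS.
move: c2; rewrite cS mulnDr muln1.
set a := visit_cost * _; set c := visit_cost * _.
by rewrite /visit_cost; lia.
Qed.

(** The root deletes nothing and comes on top of [tree_bound]: hence [n.+1] for [r = 1], and
    [1 + r * (2 * r ^ m.-1 - 1) <= 2 * r ^ m] otherwise. *)
Definition search_cost : nat := visit_cost * (if r == 1 then n.+1 else 2 * r ^ m).

Lemma search_spec s : graph_at e r s -> ranks_at K s -> reg s rV = v ->
  reg s rM = m -> marks (set0 : {set 'I_n}) s ->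
  wp search (fun s' => [/\ clk s' <= clk s + search_cost,
    reg s' rF = sep set0 m & marks (set0 : {set 'I_n}) s']) s.
Proof.
move=> gr rk sV sM mk; do 3![apply/wp_seq/wp_asg] => /=; rewrite sM.
set s0 := set_reg _ rF _; apply/wp_seq.
have v0 : v \notin set0 by rewrite inE.
apply: wp_use (node_spec (s := s0) rn gr rk sV v0 mk) _ => s1 A.
rewrite [reg s0 rD]/= [reg s0 rF]/= [stack s0]/= => -[c1 [b [p [F1 st1 [sp pS] p0 sepE]]]].
have D1 : dfs_at set0 m b p s1.
  split; split.
  - exact: (graph_at_agree A).
  - exact: (ranks_at_agree A).
  - by rewrite A.1.
  - exact: (marks_agree A).
  - by rewrite A.1.
  - by rewrite F1; case: (b).
  - by rewrite st1.
have finish s2 f : dfs_at set0 m f [::] s2 -> f = sep set0 m ->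
  clk s2 + 1 <= clk s + search_cost ->
  wp (While (Rg rSP) dfs_step) (fun s' => [/\ clk s' <= clk s + search_cost,
    reg s' rF = sep set0 m & marks (set0 : {set 'I_n}) s']) s2.
  move=> D2 <- c2; apply: wp_while0; first by rewrite /= (stack_size D2).
  by case: D2 => _ [mk2 _ F2 _]; split=> //=; lia.
case/andP: (rn) => r0 rn'.
have rX : 0 < r ^ m by rewrite expn_gt0 r0.
have [m0|m0] := posnP m.
  rewrite p0 // orbF in sepE D1; apply: (finish s1 b) => //.
  have : visit_cost * 1 <= search_cost.
    by rewrite leq_mul2l; case: ifP; lia.
  by rewrite /visit_cost; move: c1 => /=; lia.
have Em : m = m.-1.+1 by rewrite prednK.
set d := m.-1 in Em; rewrite {1}Em in D1.
apply: (explore_list (stk := [::]) (@explore d) v0 pS D1) => s2 D2 c2.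
apply: (finish s2 (b || has (fun y => sep (y |: set0) d) p)) => //; first by rewrite Em.
have : 1 + size p * tree_bound r n d 0 <= if r == 1 then n.+1 else 2 * r ^ m.
  rewrite /tree_bound; case: eqP => [r1|r1].
    rewrite subn0 ltnS -[X in _ <= X]mul1n leq_mul2r; lia.
  have : size p * (2 * r ^ d - 1) <= r * (2 * r ^ d - 1) by rewrite leq_mul2r sp orbT.
  have -> : r * (2 * r ^ d - 1) = 2 * r ^ m - r.
    by rewrite mulnBr muln1 mulnCA -expnS -Em.
  have : r <= 2 * r ^ m by rewrite Em expnS mulnCA leq_pmulr // muln_gt0 expn_gt0 r0.
  lia.
move=> le; have : visit_cost * (1 + size p * tree_bound r n d 0) <= search_cost.
  by rewrite leq_mul2l le orbT.
rewrite cards0 in c2; move: c2; rewrite mulnDr muln1; set a := visit_cost * _.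
by rewrite /visit_cost; move: c1 => /=; lia.
Qed.

End Search.

(** * Rounds, the main program and its cost *)

Notation rA := 17 (only parsing).

(** [aIn] is indexed by the original addresses, so row 0 starts at 3. Row offsets are tabulated by
    repeated addition, which leaves in [rA] the address [3 + n * n] of the output. *)
Definition main : cmd :=
  Asg rR (Get aIn (Plus (Rg rN) (Cst 4))) ;;
  Asg rM (Get aIn (Plus (Plus (Rg rN) (Rg rN)) (Cst 5))) ;;
  If (Minus (Rg rR) (Rg rN)) (Asg rR (Rg rN)) Skip ;;
  Asg rA (Cst 3) ;;
  For rW rN (Put aRow (Rg rW) (Rg rA) ;; Asg rA (Plus (Rg rA) (Rg rN))) ;;
  For rI rN round.

Section Rounds.
Variables (n : nat) (e : rel 'I_n) (r m : nat).
Hypothesis rn : 0 < r <= n.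
Implicit Types (w : 'I_n) (s : store).

Definition rank_values i s : Prop := forall w, let k := arr s aRk w in
  if k == 0 then w \notin ranked e r m i
  else [&& k <= i, w \in ranked e r m k & w \notin ranked e r m k.-1].

Lemma rank_values_ranks_at i s : rank_values i s -> ranks_at (ranked e r m i) s.
Proof.
move=> rv w; have := rv w; rewrite /=; case: eqP => [_ ->//|_ /and3P[ki wk _]].
by rewrite (subsetP (ranked_sub e r m ki) _ wk).
Qed.

Definition round_cost : nat := n * (search_cost n r m + 9) + 4.

Lemma round_spec i s : graph_at e r s -> reg s rM = m -> reg s rI = i ->
  marks (set0 : {set 'I_n}) s -> rank_values i s ->
  wp round (fun s' => [/\ clk s' <= clk s + round_cost,
    marks (set0 : {set 'I_n}) s' & rank_values i.+1 s']) s.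
Proof.
move=> gr sM sI mk rv; pose K := ranked e r m i.
have rk : ranks_at K s by exact: rank_values_ranks_at.
have sN : reg s rN = n by case: gr.
apply/wp_seq/(wp_for (N := n) (Inv := fun j s' => [/\
  clk s' <= clk s + 1 + (search_cost n r m + 4) * j, marks (set0 : {set 'I_n}) s'
  & forall w, w < j -> w \notin K -> arr s' aOk w = separable e r w K set0 m])) => //.
- by split=> //=; lia.
- move=> j s' jn A sj [c' mk' ok]; pose w := Ordinal jn; have Ew : j = w by [].
  have lt w' : w' < j.+1 -> w' = w \/ w' < j.
    by rewrite ltnS leq_eqVlt => /predU1P[E|]; [left; apply: val_inj | right].
  apply/wp_if => /=; rewrite sj A.2 // Ew rk; case: ifPn => wK; last first.
    apply/wp_skip; split=> //; first by move: c' => /=; lia.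
    by move=> w' /lt[->|/ok//]; rewrite (negbTE wK).
  apply/wp_seq; apply: wp_use
    (search_spec (e := e) (v := w) (K := K) rn (m := m) _ _ _ _ _) _ => //.
  + exact: (graph_at_agree A).
  + exact: ranks_at_agree A _ rk.
  + by rewrite /= A.1.
  move=> s2 A2 [c2 F2 mk2]; apply/wp_put; split=> //; first by move: c2 c' => /=; lia.
  have V2 : reg s2 rV = j by rewrite A2.1.
  move=> w' /lt[->|w'j] w'K; first by rewrite /= V2 eqxx F2.
  by rewrite /= V2 ltn_eqF // A2.2 //; apply: ok.
move=> s1 A1 [c1 mk1 ok1].
(* [arr s aRk] holds the ranks at the start of the round; the first loop does not write them, so all
   tests used the same [K]. *)
apply: (wp_for (N := n) (Inv := fun j s' => clk s' <= clk s1 + 2 + 5 * j /\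
  forall w, arr s' aRk w = if (w < j) && (arr s aRk w == 0) && (arr s1 aOk w != 0)
                           then i.+1 else arr s aRk w)) => //.
- by rewrite /= A1.1.
- by split=> [|w]; rewrite /= ?A1.2 //; lia.
- move=> j s' jn A sj [c' rk']; pose w := Ordinal jn; have Ew : j = w by [].
  have lt w' : w' != w -> (w' < j.+1) = (w' < j).
    by rewrite ltnS leq_eqVlt; case: (w' =P j :> nat) => // E /eqP[]; apply: val_inj.
  have arr_w : arr s' aRk w = arr s aRk w by rewrite rk' ltnn.
  have keep s2 : clk s2 <= clk s' + 4 -> arr s2 aRk = arr s' aRk ->
      (arr s aRk w == 0) && (arr s1 aOk w != 0) = false ->
      clk (set_reg s2 rV j.+1) <= clk s1 + 2 + 5 * j.+1 /\
      (forall w, arr (set_reg s2 rV j.+1) aRk w =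
         if (w < j.+1) && (arr s aRk w == 0) && (arr s1 aOk w != 0)
         then i.+1 else arr s aRk w).
    move=> c2 E2 F; split; first by rewrite /=; lia.
    move=> w'; rewrite /= E2 rk'; have [->|/lt->//] := eqVneq w' w.
    by rewrite -!andbA F !andbF.
  apply/wp_if; rewrite /= sj {1}Ew arr_w; case: ifPn => wK; last first.
    by apply/wp_skip/keep; rewrite /= ?(negbTE wK) //; lia.
  have ok_w : arr s' aOk j = arr s1 aOk w by rewrite A.2.
  apply/wp_if; rewrite /= sj ok_w; case: ifPn => okw.
    by apply/wp_skip/keep; rewrite /= ?okw ?andbF //; lia.
  apply/wp_put; split; first by move: c' => /=; lia.
  move=> w'; rewrite /= sj A.1 //= A1.1 //= sI addn1.
  have [->|neq] := eqVneq w' w; first by rewrite eqxx ltnSn wK okw.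
  by rewrite ifN ?lt.
- move=> s2 A2 [c2 rk2]; split; first by rewrite /round_cost; move: c2 c1 => /=; lia.
    by apply: (marks_agree A2).
  move=> w; rewrite /= rk2 ltn_ord /=.
  have := rv w; rewrite /=; case: (eqVneq (arr s aRk w) 0) => [->|k0] /=.
    move=> wK; rewrite ok1 // eqb0 negbK.
    have E : (w \in ranked e r m i.+1) = separable e r w K set0 m.
      by rewrite (in_rankedS w (erefl K)) (negbTE wK).
    by case: (separable e r w K set0 m) E => -> //=; rewrite ltnS leqnn.
  by rewrite (negbTE k0) => /and3P[ki -> ->]; rewrite (leq_trans ki).
Qed.

End Rounds.

Section Main.
Variables (n : nat) (e : rel 'I_n) (r0 m : nat).
Implicit Types (u w : 'I_n) (s : store).
Local Notation r := (minn r0 n).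

Definition main_cost : nat := n * (round_cost n r m + 2) + 4 * n + 9.

Lemma main_spec s : 0 < n -> 0 < r0 -> reg s rN = n ->
  arr s aIn (n + 4) = r0 -> arr s aIn (n + n + 5) = m ->
  (forall u w, u != w -> arr s aIn (3 + u * n + w) = e u w) ->
  (forall w, arr s aRk w = 0) -> (forall w, arr s aS w = 0) ->
  wp main (fun s' => [/\ clk s' <= clk s + main_cost, reg s' rN = n,
    reg s' rA = 3 + n * n & rank_values e r m n s']) s.
Proof.
move=> n0 r0p sN sr sm mat rk0 mk0.
have rn : 0 < r <= n by rewrite leq_min r0p n0 geq_minr.
apply/wp_seq/wp_asg/wp_seq/wp_asg; rewrite /= sN sr sm.
set s1 := set_reg _ rM _.
apply/wp_seq; have : wp (If (Minus (Rg rR) (Rg rN)) (Asg rR (Rg rN)) Skip)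
   (fun s2 => clk s2 <= clk s + 4 /\ reg s2 rR = r) s1.
  apply/wp_if; rewrite /= sN; case: eqP => r0n.
    by apply/wp_skip; split; rewrite /=; lia.
  by apply/wp_asg; split; rewrite /= ?sN; lia.
move/wp_use; apply=> s2 A2 [c2 R2].
apply/wp_seq/wp_asg => /=; apply/wp_seq.
apply: (wp_for (N := n) (Inv := fun j s' => [/\ clk s' <= clk s + 6 + 4 * j,
  reg s' rA = 3 + j * n & forall i, i < j -> arr s' aRow i = 3 + i * n])) => //.
- by rewrite /= A2.1.
- by split=> //=; lia.
- move=> j s' jn A sj [c' rA' row]; apply/wp_seq/wp_put/wp_asg; split.
  + by move: c' => /=; lia.
  + by rewrite /= rA' A.1 //= A2.1 //= sN mulSn; lia.
  + by move=> i; rewrite /= sj rA' ltnS leq_eqVlt; case: eqP => [->//|_ /row].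
move=> s3 A3 [c3 rA3 row3].
have gr3 : graph_at e r s3.
  split; first by rewrite A3.1 //= A2.1.
    by rewrite A3.1.
  by move=> u w uw; rewrite row3 // A3.2 //= A2.2 //= mat.
have M3 : reg s3 rM = m by rewrite A3.1 //= A2.1.
apply: (wp_for (N := n) (Inv := fun i s' => [/\
  clk s' <= clk s + 8 + 4 * n + (round_cost n r m + 2) * i,
  marks (set0 : {set 'I_n}) s' & rank_values e r m i s'])) => //.
- by case: gr3.
- split; first by move: c3 => /=; lia.
    by move=> w; rewrite /= A3.2 //= A2.2 //= mk0 inE.
  by move=> w; rewrite /= A3.2 //= A2.2 //= rk0 inE.
- move=> i s' _ A si [c' mk' rv'].
  apply: wp_mono (round_spec (s := tick s') rn _ _ si mk' rv') _.
  + exact: graph_at_agree A _ _ gr3.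
  + by rewrite /= A.1.
  + move=> s4 [c4 mk4 rv4]; split=> //; move: c4 c' => /=; lia.
- move=> s4 A [c4 _ rv4]; split=> //.
  + rewrite /main_cost; move: c4 => /=; lia.
  + by rewrite /= A.1 //; case: gr3.
  + by rewrite /= A.1.
Qed.

Lemma main_cost_bound : 0 < n -> 0 < r0 -> main_cost <= 148 * (r0 ^ m * n ^ 4).
Proof.
move=> n0 r0p.
have rn : 0 < r <= n by rewrite leq_min r0p n0 geq_minr.
case/andP: rn => rp rn.
have X0 : 0 < r ^ m by rewrite expn_gt0 rp.
pose Y := n * n * r ^ m.
have Y0 : 0 < Y by rewrite !muln_gt0 n0.
(* The cost is [25 * n + 35] for [r = 1], and [8 * n * n + 23 * n + 29] otherwise. *)
have visit : visit_cost n r <= 60 * n * (if r == 1 then 1 else n).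
  by rewrite /visit_cost /node_cost /bfs_cost; case: ifP => _; nia.
have srch : search_cost n r m <= 120 * Y.
  rewrite /search_cost; apply: leq_trans (leq_mul visit (leqnn _)) _.
  rewrite /Y; case: ifP => [/eqP r1|_]; last by nia.
  by rewrite r1 exp1n; nia.
(* 148 is 120 + 9 + 6 + 4 + 9, each lower-order term being rounded up to [n * n * Y]. *)
have : main_cost <= 148 * (n * n * Y).
  have : n * (round_cost n r m + 2) <= n * (n * (120 * Y + 9) + 6).
    by rewrite /round_cost leq_mul2l; apply/orP; right; nia.
  have : n <= n * n * Y by nia.
  have : n * n <= n * n * Y by rewrite leq_pmulr.
  rewrite /main_cost; nia.
move/leq_trans; apply; rewrite leq_mul2l /=.
have -> : n * n * Y = r ^ m * n ^ 4 by rewrite /Y !expnS expn0 muln1 !mulnA; lia.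
rewrite leq_mul2r; apply/orP; right.
by have [->|mp] := posnP m; rewrite ?expn0 // leq_exp2r ?geq_minl.
Qed.

End Main.

(** * Relocating the input and writing the output *)

Fixpoint block (i : instr) (l : seq instr) : code :=
  if l is j :: l' then Sq (Op i) (block j l') else Op i.

Fixpoint block_eff (i : instr) (l : seq instr) (M : memory) : option memory :=
  if l is j :: l' then obind (block_eff j l') (op_eff i M) else op_eff i M.

Lemma block_run i l M M' : block_eff i l M = Some M' ->
  crun (block i l) M M' (size l).+1.
Proof.
elim: l i M => [|j l IH] i M /=; first exact: crun_op.
case E: (op_eff i M) => [M1|] //= H.
exact: (crun_sq (crun_op E) (IH _ _ H)).
Qed.

Lemma upd_eq M a x : upd M a x a = x.
Proof. by rewrite /= eqxx. Qed.

Lemma upd_neq M a x b : b != a -> upd M a x b = M b.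
Proof. by move=> /negbTE /= ->. Qed.

Definition square_loop : code := Lp 1 (block (IAdd 2 2 0) [:: ISub 1 1 3]).

Lemma square_loop_run c M : M 1 = c -> M 3 = 1 ->
  exists2 M', crun square_loop M M' (4 * c + 1) &
    M' 2 = M 2 + c * M 0 /\ forall a, a != 1 -> a != 2 -> M' a = M a.
Proof.
elim: c M => [|c IH] M M1 M3; first by exists M; [apply: crun_lp0 | rewrite addn0].
pose M2 := upd (upd M 2 (M 2 + M 0)) 1 c.
have [||M' run' [E' same]] := IH M2 => //.
exists M'; last first.
  split=> [|a /negbTE a1 /negbTE a2]; first by rewrite E' /M2 /= mulSn; lia.
  by rewrite same ?a1 ?a2 // /M2 /= a1 a2.
have -> : 4 * c.+1 + 1 = 1 + (2 + (1 + (4 * c + 1))) by lia.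
apply: crun_lpS run'; first by rewrite M1.
by apply: block_run => /=; rewrite M1 M3 subn1.
Qed.

Definition copy_loop : code :=
  Lp 1 (block (ILoad 3 1) [:: IStore 2 3; IConst 3 1; ISub 1 1 3; IConst 3 8; ISub 2 2 3]).

(** Only cells 1 to 3 serve as scratch, so constants are reloaded in each iteration and faithful
    copies are claimed from address 4 on. Targets lie above [base], sources below it. *)
Lemma copy_loop_run c base M : M 1 = c -> M 2 = base + 8 * c -> c < base -> 4 <= base ->
  exists2 M', crun copy_loop M M' (8 * c + 1) &
    [/\ M' 2 = base, M' 0 = M 0,
      forall a, 4 <= a <= c -> M' (base + 8 * a) = M a
    & forall a, 4 <= a -> (forall i, 0 < i <= c -> a != base + 8 * i) -> M' a = M a].
Proof.
elim: c M => [|c IH] M M1 M2 cb b4.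
  exists M; first exact: crun_lp0.
  by split=> //; [rewrite M2; lia | lia].
pose Ma := upd (upd M 3 (M c.+1)) (base + 8 * c.+1) (M c.+1).
pose Mb := upd (upd (upd (upd Ma 3 1) 1 c) 3 8) 2 (base + 8 * c).
have Mb_new : Mb (base + 8 * c.+1) = M c.+1.
  by rewrite /Mb /Ma 4?upd_neq ?upd_eq //; lia.
have Mb_old a : 4 <= a -> a != base + 8 * c.+1 -> Mb a = M a.
  by move=> a4 ne; rewrite /Mb /Ma !upd_neq //; lia.
have [||||M' run' [E2 E0 cp same]] := IH Mb => //; first lia.
exists M'; last first.
  split=> //.
  - by rewrite E0 /Mb /Ma /=; case: eqP => //; lia.
  - move=> a /andP[a4]; rewrite leq_eqVlt => /predU1P[->|ac].
      by rewrite same //; [lia | move=> i; lia].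
    by rewrite cp ?a4 // Mb_old //; lia.
  - move=> a a4 ne; rewrite same ?Mb_old //; first by apply: ne; lia.
    by move=> i ic; apply: ne; lia.
have -> : 8 * c.+1 + 1 = 1 + (6 + (1 + (8 * c + 1))) by lia.
apply: crun_lpS run'; first by rewrite M1.
apply: block_run; rewrite /= M1 M2 /Mb /Ma.
have -> : (1 == base + 8 * c.+1) = false by lia.
have -> : (2 == base + 8 * c.+1) = false by lia.
rewrite /= ?M1 ?M2 subn1.
by have -> : base + 8 * c.+1 - 8 = base + 8 * c by lia.
Qed.

Definition output_loop : code :=
  Lp 0 (block (ILoad 3 1)
    [:: IStore 2 3; IConst 3 8; IAdd 1 1 3; IConst 3 1; IAdd 2 2 3; ISub 0 0 3]).

(** The output may overwrite registers, as [dst] can be as small as 4; hence the loop works in cells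
    0 to 3 alone. *)
Lemma output_loop_run c src dst M : M 0 = c -> M 1 = src -> M 2 = dst ->
  4 <= dst -> dst + c <= src ->
  exists2 M', crun output_loop M M' (9 * c + 1) &
    (forall i, i < c -> M' (dst + i) = M (src + 8 * i)) /\
    (forall a, 4 <= a < dst -> M' a = M a).
Proof.
elim: c src dst M => [|c IH] src dst M M0 M1 M2 d4 ds.
  by exists M; first exact: crun_lp0.
pose Ma := upd (upd M 3 (M src)) dst (M src).
pose Mb := upd (upd (upd (upd (upd Ma 3 8) 1 (src + 8)) 3 1) 2 (dst + 1)) 0 c.
have Mb_new : Mb dst = M src.
  by rewrite /Mb /Ma 5?upd_neq ?upd_eq //; lia.
have Mb_old a : 4 <= a -> a != dst -> Mb a = M a.
  by move=> a4 ne; rewrite /Mb /Ma !upd_neq //; lia.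
have [|||||M' run' [cp same]] := IH (src + 8) (dst + 1) Mb => //; [lia | lia |].
exists M'; last first.
  split=> [[_|i ic]|a Ha].
  - by rewrite addn0 muln0 addn0 same //; lia.
  - have -> : dst + i.+1 = dst + 1 + i by lia.
    rewrite cp //.
    have -> : src + 8 + 8 * i = src + 8 * i.+1 by lia.
    by rewrite Mb_old //; lia.
  - by rewrite same ?Mb_old //; lia.
have -> : 9 * c.+1 + 1 = 1 + (7 + (1 + (9 * c + 1))) by lia.
apply: crun_lpS run'; first by rewrite M0.
apply: block_run; rewrite /= M1 M2 /Mb /Ma.
have -> : (0 == dst) = false by lia.
have -> : (1 == dst) = false by lia.
have -> : (2 == dst) = false by lia.
by rewrite /= ?M0 ?M1 ?M2 subn1.
Qed.

(* The adjacency matrix occupies every cell from 3 on, so besides cells 0, 1, 2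
   only the diagonal cells, which the search never reads, are free: cells 3, [n + 4]
   and [2n + 5] are diagonal or lie beyond the matrix, and the last two receive [r]
   and [m]. *)
Definition save_r : code := block (IConst 3 4) [:: IAdd 3 3 0; IStore 3 1].

Definition save_m : code := block (IConst 1 5) [:: IAdd 1 1 0; IAdd 1 1 0; IStore 1 2].

Definition init_square : code := block (IConst 2 0) [:: IAdd 1 2 0; IConst 3 1].

(** With [L] as in [boot_run], cell 1 receives [L] and cell 2 receives [9 * L + 100], the target
    address of cell [L]. *)
Definition init_copy : code :=
  block (IConst 1 5) [:: IAdd 1 1 2; IAdd 1 1 0; IAdd 1 1 0; IAdd 2 1 1;
    IAdd 2 2 2; IAdd 2 2 2; IAdd 2 2 1; IConst 3 100; IAdd 2 2 3].

Definition save_base : code := block (IConst 3 0) [:: IAdd 39 2 3].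

Definition boot : code :=
  Sq save_r (Sq save_m (Sq init_square (Sq square_loop
    (Sq init_copy (Sq copy_loop save_base))))).

(** [L] bounds the addresses of the matrix, of the two saved cells and of the output block; the
    extra 100 clears registers and temporaries. *)
Lemma boot_run M n r m (L := n * n + n + n + 5) (b := L + 100) :
  M 0 = n -> M 1 = r -> M 2 = m ->
  exists2 M', crun boot M M' (4 * n + 8 * L + 24) &
    [/\ M' 0 = n, M' 39 = b, M' (b + 8 * (n + 4)) = r & M' (b + 8 * (n + n + 5)) = m] /\
    [/\ forall a, 4 <= a <= L -> a != n + 4 -> a != n + n + 5 -> M' (b + 8 * a) = M a
      & forall a, b <= a -> (forall i, 0 < i <= L -> a != b + 8 * i) -> M' a = M a].
Proof.
move=> M0 M1 M2.
have [Ma [runa ra samea]] : exists Ma, [/\ crun save_r M Ma 3, Ma (n + 4) = r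
    & forall a, a != 3 -> a != n + 4 -> Ma a = M a].
  eexists; split; first exact: block_run.
    by rewrite /= M0 M1 [4 + n]addnC eqxx.
  by move=> a a3 a4; rewrite /= M0 [4 + n]addnC (negbTE a3) (negbTE a4).
have [Mb [runb mb sameb]] : exists Mb, [/\ crun save_m Ma Mb 4, Mb (n + n + 5) = m
    & forall a, a != 1 -> a != n + n + 5 -> Mb a = Ma a].
  have Ma0 : Ma 0 = n by rewrite samea //; lia.
  have E : 5 + n + n = n + n + 5 by lia.
  eexists; split; first exact: block_run.
    by rewrite /= Ma0 E eqxx samea ?M2 //; lia.
  by move=> a a3 a4; rewrite /= Ma0 E (negbTE a3) (negbTE a4).
have Mb0 : Mb 0 = n by rewrite sameb ?samea ?M0 //; lia.
have [Mc [runc mc1 mc2 mc3 samec]] : exists Mc, [/\ crun init_square Mb Mc 3, Mc 1 = n,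
    Mc 2 = 0, Mc 3 = 1 & forall a, a = 0 \/ 4 <= a -> Mc a = Mb a].
  eexists; split; first exact: block_run; rewrite //=.
  by move=> a Ha; rewrite !ifN //; lia.
have [Md rund [md2 samed]] := square_loop_run mc1 mc3.
rewrite mc2 samec ?Mb0 in md2; last by left.
have Md0 : Md 0 = n by rewrite samed // samec ?Mb0 //; left.
have [Me [rune me1 me2 samee]] : exists Me, [/\ crun init_copy Md Me 10, Me 1 = L,
    Me 2 = b + 8 * L & forall a, a = 0 \/ 4 <= a -> Me a = Md a].
  eexists; split; first exact: block_run; rewrite //=; rewrite ?Md0 ?md2 /b /L; try lia.
  by move=> a Ha; rewrite !ifN //; lia.
have [||Mf runf [mf2 mf0 cp samef]] := copy_loop_run me1 me2; rewrite /b; try lia.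
have old a : 4 <= a -> a != n + 4 -> a != n + n + 5 -> Me a = M a.
  move=> a4 an am; rewrite samee ?samed ?samec ?sameb ?samea //; lia.
have Me_r : Me (n + 4) = r.
  by rewrite samee ?samed ?samec ?sameb ?ra //; lia.
have Me_m : Me (n + n + 5) = m.
  by rewrite samee ?samed ?samec ?mb //; lia.
eexists.
  have -> : 4 * n + 8 * L + 24 = 3 + (4 + (3 + (4 * n + 1 + (10 + (8 * L + 1 + 2))))) by lia.
  apply: crun_sq runa (crun_sq runb (crun_sq runc (crun_sq rund (crun_sq rune (crun_sq runf _))))).
  exact: block_run.
split; split.
- by rewrite /= mf0 samee ?Md0 //; left.
- by rewrite /= mf2 addn0.
- by rewrite !upd_neq ?cp //; lia.
- by rewrite !upd_neq ?cp //; lia.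
- by move=> a Ha an am; rewrite !upd_neq ?cp ?old //; lia.
- by move=> a Ha ne; rewrite !upd_neq ?samef ?old //; lia.
Qed.

Definition init_output : code :=
  block (IConst 3 1) [:: IAdd 1 39 3; IConst 3 0; IAdd 2 17 3].

Lemma output_run M n dst : M 0 = n -> M 17 = dst -> 4 <= dst -> dst + n <= M 39 ->
  exists2 M', crun (Sq init_output output_loop) M M' (9 * n + 5) &
    forall i, i < n -> M' (dst + i) = M (M 39 + 8 * i + 1).
Proof.
move=> M0 M17 d4 db.
have [Ma [runa a0 a1 a2 same]] : exists Ma, [/\ crun init_output M Ma 4, Ma 0 = n,
    Ma 1 = M 39 + 1, Ma 2 = dst & forall a, 4 <= a -> Ma a = M a].
  eexists; split; first exact: block_run; rewrite //=.
    by rewrite M17 addn0.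
  by move=> a Ha; rewrite !ifN //; lia.
have [||M' run' [out _]] := output_loop_run a0 a1 a2 => //; first lia.
exists M'; first by have -> : 9 * n + 5 = 4 + (9 * n + 1) by [lia]; apply: crun_sq run'.
move=> i Hi; rewrite out // same; last by lia.
by congr M; lia.
Qed.

(** * The complete program *)

Definition rank_code : code :=
  Sq boot (Sq (cmd_code main) (Sq init_output output_loop)).

Lemma input_mem_edge n (e : rel 'I_n) r m (u w : 'I_n) :
  input_mem e r m (3 + u * n + w) = e u w.
Proof.
have n0 : 0 < n by apply: leq_ltn_trans (ltn_ord u).
rewrite /input_mem.
have -> : (3 + u * n + w == 0) = false by lia.
have -> : (3 + u * n + w == 1) = false by lia.
have -> : (3 + u * n + w == 2) = false by lia.
have -> : (3 <= 3 + u * n + w < 3 + n * n) = true.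
  rewrite -!addnA leq_addr ltn_add2l /=.
  have : u * n + n <= n * n by rewrite addnC -mulSn leq_mul2r ltn_ord orbT.
  by have := ltn_ord w; lia.
have -> : 3 + u * n + w - 3 = u * n + w by lia.
by rewrite divnMDl // modnMDl divn_small // modn_small // addn0 !valK.
Qed.

Lemma input_mem_large n (e : rel 'I_n) r m a :
  3 + n * n <= a -> input_mem e r m a = 0.
Proof. by move=> Ha; rewrite /input_mem !ifN //; lia. Qed.

(** Used for [i] equal to 0, 1 and 2, that is, for cells 3, [n + 4] and [2n + 5]. There is no bound
    on [i], because in small graphs these cells lie beyond the matrix. *)
Lemma offdiagonal n (u w i : nat) : u < n -> w < n -> u != w -> u * n + w != i * n + i.
Proof.
move=> un wn; apply: contra_neq => E.
have n0 : 0 < n by lia.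
have [iN|iN] := ltnP i n.
  have := congr1 (divn^~ n) E; rewrite !divnMDl // !divn_small // !addn0.
  by have := congr1 (modn^~ n) E; rewrite !modnMDl !modn_small // => -> ->.
have : u * n + n <= n * n by rewrite addnC -mulSn leq_mul2r un orbT.
have : n * n <= i * n by rewrite leq_mul2r iN orbT.
lia.
Qed.

Lemma rank_code_run n (e : rel 'I_n) r m : 0 < n -> 0 < r ->
  exists M' t, [/\ crun rank_code (input_mem e r m) M' t,
    t <= (148 * csize (cmd_code main) + 200) * (r ^ m * n ^ 4)
  & forall v, is_rank e r m v (output_rank M' v)].
Proof.
move=> n0 r0.
have [||| M1 run1 [[M1n M1b M1r M1m] [old new]]] := @boot_run (input_mem e r m) n r m => //.
set L := n * n + n + n + 5 in run1 M1b M1r M1m old new; set b := L + 100 in M1b M1r M1m old new.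
pose s := Store M1 (fun k i => M1 (b + 8 * i + k)) 0.
have rep1 : represents L s M1 by split; rewrite ?M1b //; rewrite /b; lia.
(* The copy fills array 0 only; cells of the other arrays lie past the input and are still zero. *)
have zero k (w : 'I_n) : 0 < k < 8 -> M1 (b + 8 * w + k) = 0.
  by move=> Hk; rewrite new ?input_mem_large //; rewrite /b /L; lia.
have [||||||||s' ex [c' N' A' rv]] := @main_spec n e r m s => //.
- by rewrite /= addn0.
- by rewrite /= addn0.
- move=> u w uw; rewrite [LHS]/= addn0 old ?input_mem_edge //.
  + have : u * n + n <= n * n by rewrite addnC -mulSn leq_mul2r ltn_ord orbT.
    have := @offdiagonal n u w 0 (ltn_ord u) (ltn_ord w) uw.
    by have := ltn_ord w; rewrite /L; lia.
  + by have := @offdiagonal n u w 1 (ltn_ord u) (ltn_ord w) uw; lia.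
  + by have := @offdiagonal n u w 2 (ltn_ord u) (ltn_ord w) uw; lia.
- by move=> w; apply: zero.
- by move=> w; apply: zero.
have wf : wf_cmd main by [].
have [M2 [t2 [run2 [b2 regs arrs] le2]]] := cmd_code_run ex wf (leqnn _) rep1.
have M2n : M2 0 = n by rewrite regs.
have M2d : M2 17 = 3 + n * n by rewrite regs.
have d4 : 4 <= 3 + n * n by have : 0 < n * n by [rewrite muln_gt0 n0]; lia.
(* The parameter [lo] of [represents] was set to [L] for this: the output block ends below the
   arrays. *)
have db : 3 + n * n + n <= M2 39 by rewrite /L in b2; lia.
have [M3 run3 out] := output_run M2n M2d d4 db.
exists M3; eexists; split.
- exact: crun_sq run1 (crun_sq run2 run3).
(* Start-up and output take [8 * n * n + 29 * n + 69] steps, which the summand 200 covers. *)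
- have := @main_cost_bound n r m n0 r0.
  set X := r ^ m * n ^ 4 => mainX.
  have nX : n * n <= X.
    rewrite /X !expnS expn0 muln1 !mulnA -[X in X <= _]mul1n -mulnA.
    have : 0 < r ^ m by rewrite expn_gt0 r0.
    by nia.
  have : csize (cmd_code main) * main_cost n r m <= csize (cmd_code main) * (148 * X).
    by rewrite leq_mul2l mainX orbT.
  have : t2 <= csize (cmd_code main) * main_cost n r m.
    by move: le2; rewrite muln0 addn0 => /leq_trans-> //; rewrite leq_mul2l c' orbT.
  move: (csize _) => W; rewrite /L; nia.
- move=> v; rewrite /output_rank out // arrs //.
  have := rv v; rewrite /decode_rank /=; case: eqP => [_|/eqP k0].
    rewrite ranked_cap => vn i; apply: contra vn => vi.
    have [ni|ni] := leqP n i; first by rewrite -(ranked_stable e r m ni).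
    exact: (subsetP (ranked_sub e r m (ltnW ni))).
  by rewrite !ranked_cap => /and3P[_ vk vk1]; split; rewrite ?lt0n.
Qed.

Theorem theorem3p3 :
  exists (P : program) (C : nat),
    forall (n : nat) (e : rel 'I_n) (r m : nat),
      symmetric e -> irreflexive e -> 0 < n -> 0 < r ->
      exists t : nat,
        t <= C * (r ^ m * n ^ 4) /\
        halted P (run P t (init_state e r m)) /\
        forall v : 'I_n,
          is_rank e r m v (output_rank (st_mem (run P t (init_state e r m))) v).
Proof.
exists (assemble 0 rank_code ++ [:: IHalt]), (148 * csize (cmd_code main) + 200).
move=> n e r m _ _ n0 r0.
have [M [t [runM tC ranks]]] := rank_code_run e m n0 r0.
have [E halt] := assemble_halts runM.
by exists t; rewrite /init_state E.
Qed.
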